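(* Let $n\ge 2$, let $X\subseteq F_n$, and let $H=\langle X\rangle$ be the subgroup of $F_n$ generated by $X$. Assume that the following conditions hold. (1) $[F_n,F_n]\subseteq \mathrm{Cl}(H)$. (2) $H[F_n,F_n]=F_n$. (3) For each $i\in\{0,\dots,n-2\}$ there exist an element $h_i\in H$ and a point $\alpha_i\in D_{n,i}$ such that $h_i(\alpha_i)=\alpha_i$, $h_i'(\alpha_i^-)=1$ and $h_i'(\alpha_i^+)=n$. (4) There exists an inner $n$-ary word $u$ such that for every two finite $n$-ary words $v_1,v_2$ with $t(v_1)=t(v_2)$, the paths labeled by $uv_1$ and $uv_2$ in the semi-core $\mathcal L_{sem}(X)$ have the same terminal vertex, that is, $(uv_1)^+=(uv_2)^+$ in $\mathcal L_{sem}(X)$. Then $X$ generates $F_n$.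
   Context: $F_n$ ($n\ge2$) is the group of all piecewise-linear homeomorphisms of $[0,1]$ with finitely many breakpoints, all in $\mathbb Z[\frac1n]$, and with all slopes integer powers of $n$; products are composed from left to right, $(fg)(x)=g(f(x))$. $[F_n,F_n]$ is the derived subgroup. $h'(\alpha^-)$ and $h'(\alpha^+)$ are the left and right derivatives of $h$ at $\alpha$. Words: a finite $n$-ary word is a finite (possibly empty) string over $\{0,\dots,n-1\}$; a nonempty word is inner if it is not of the form $0^k$ or $(n-1)^k$. For $\sigma=\sigma_1\cdots\sigma_l$ put $.\sigma=\sum_j\sigma_jn^{-j}$, $[\sigma]=[.\sigma,.\sigma+n^{-l}]$, and $t(\sigma)=\sum_j\sigma_j \bmod (n-1)$. For $\alpha\in\mathbb Z[\frac1n]\cap(0,1)$, $t(\alpha)=t(\sigma)$ for any finite word $\sigma$ with $\alpha=.\sigma$. $D_{n,i}=\{\alpha\in\mathbb Z[\frac1n]\cap(0,1): t(\alpha)=i\}$. Trees: an $n$-ary tree is a finite rooted tree in which each vertex has either $0$ children (a leaf) or exactly $n$ ordered children, edges being directed away from the root and labeled $0,\dots,n-1$ in order. A branch is a root-to-leaf path, identified with the $n$-ary word labeling it. A tree-diagram is a pair $(T_1,T_2)$ of $n$-ary trees with the same number of leaves; if $u_1,\dots,u_m$ and $v_1,\dots,v_m$ are the branches of $T_1$ and $T_2$ from left to right, its pairs of branches are $u_j\to v_j$, and it represents the element of $F_n$ mapping $[u_j]$ linearly onto $[v_j]$ for all $j$. It is reduced if it is not obtained from another tree-diagram by adding a common caret,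 i.e. by attaching $n$ children to both leaves of some pair of branches; each element of $F_n$ has a unique reduced tree-diagram. Semi-core and core: let $X\subseteq F_n$. Take the disjoint union of all trees occurring in the reduced tree-diagrams of elements of $X$, identify all the roots to a single vertex $r$ (the root), and for each such tree-diagram and each of its pairs of branches $u\to v$ identify the leaf $u$ of the first tree with the leaf $v$ of the second. A folding of type 1: if a vertex has several outgoing edges with the same label, identify these edges to one edge and their end vertices to one vertex. Applying foldings of type 1 as long as possible (in the limit, if $X$ is infinite) gives the semi-core $\mathcal L_{sem}(X)$. A folding of type 2: if two distinct vertices both have $n$ outgoing edges and for each $i$ their $i$-th children coincide, identify the two vertices and the corresponding outgoing edges. Applying foldings of type 2 to $\mathcal L_{sem}(X)$ as long as possible gives the core $\mathcal L(X)$; it depends only on $H=\langle X\rangle$ and is also denoted $\mathcal L(H)$. In these automata each vertex has $0$ or $n$ outgoing edges, labeled $0,\dots,n-1$. All paths are finite directed paths starting at $r$; a word $w$ labels at most one path, and if it labels one, $w^+$ is the terminal vertex of that path. Closure: a tree-diagram is accepted by $\mathcal L(H)$ if all branches of both trees label paths in $\mathcal L(H)$ and $u^+=v^+$ for each of its pairs of branches $u\to v$. An element of $F_n$ is accepted if some tree-diagram representing it is accepted (equivalently, its reduced tree-diagram is). $\mathrm{Cl}(H)$ is the subgroup of all elements of $F_n$ accepted by $\mathcal L(H)$. *)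

(* Defs.v *)
From HB Require Import structures.
From Stdlib Require Import Relation_Operators.
From mathcomp Require Import all_boot all_order all_algebra.
From mathcomp Require Import all_classical all_reals all_analysis.

Set Implicit Arguments.
Unset Strict Implicit.
Unset Printing Implicit Defensive.

Import Order.TTheory GRing.Theory Num.Theory.
Import numFieldNormedType.Exports.

Local Open Scope classical_set_scope.
Local Open Scope ring_scope.

Notation word n := (seq 'I_n).

Definition inner n (w : word n) : bool :=
  [&& w != [::], ~~ all (fun i : 'I_n => i == 0%N :> nat) w
    & ~~ all (fun i : 'I_n => i == n.-1 :> nat) w].

(* For n = 2 the type is always 0, since m %% 1 = 0. *)
Definition wtype n (w : word n) : nat :=
  ((\sum_(i <- w) nat_of_ord i) %% n.-1)%N.

Inductive tree (n : nat) : Type :=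
| Leaf
| Node of {ffun 'I_n -> tree n}.

Arguments Leaf {n}.

Fixpoint branches n (T : tree n) : seq (word n) :=
  match T with
  | Leaf => [:: [::]]
  | Node c => flatten [seq [seq i :: w | w <- branches (c i)] | i <- enum 'I_n]
  end.

(* The vertices of a tree, named by the words labeling the paths from its
   root. *)
Definition is_vertex n (T : tree n) (w : word n) : Prop :=
  exists v, w ++ v \in branches T.

(* Junk value: [add_caret w T] is [T] when [w] is not a branch of [T]. *)
Fixpoint add_caret n (w : word n) (T : tree n) : tree n :=
  match w, T with
  | [::], Leaf => Node [ffun => Leaf]
  | i :: w', Node c =>
      Node [ffun j => if j == i then add_caret w' (c j) else c j]
  | _, _ => T
  end.

Definition is_diagram n (D : tree n * tree n) : Prop :=
  size (branches D.1) = size (branches D.2).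

Definition branch_pairs n (D : tree n * tree n) : seq (word n * word n) :=
  zip (branches D.1) (branches D.2).

Definition reduced n (D : tree n * tree n) : Prop :=
  is_diagram D /\
  ~ exists E p, [/\ is_diagram E, p \in branch_pairs E
                  & D = (add_caret p.1 E.1, add_caret p.2 E.2)].

Record automaton (n : nat) := Automaton {
  vert : Type;
  aroot : vert;
  edge : vert -> 'I_n -> vert -> Prop
}.

Fixpoint path_from n (A : automaton n) (a : vert A) (w : word n) (b : vert A) :
    Prop :=
  match w with
  | [::] => a = b
  | i :: w' => exists c, edge a i c /\ path_from c w' b
  end.

(* [w1^+ = w2^+]: both words label paths from the root, and these end at the
   same vertex. *)
Definition same_end n (A : automaton n) (w1 w2 : word n) : Prop :=
  exists z, path_from (aroot A) w1 z /\ path_from (aroot A) w2 z.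

Definition eclass (V : Type) (e : V -> V -> Prop) : Type :=
  {C : set V | exists a, C = e a}.

Definition mkclass (V : Type) (e : V -> V -> Prop) (a : V) : eclass e :=
  exist _ (e a) (ex_intro _ a erefl).

(* The automaton obtained from [A] by identifying [e]-equivalent vertices,
   together with the parallel edges of the same label that this produces. *)
Definition quotient n (A : automaton n) (e : vert A -> vert A -> Prop) :
    automaton n :=
  Automaton (mkclass e (aroot A))
    (fun C i D => exists a b,
       [/\ edge a i b, C = mkclass e a & D = mkclass e b]).

(* Folding as long as possible, in the limit, identifies two vertices iff they
   are related by the least equivalence relation closed under the folding
   rule. *)
Inductive fold1 n (A : automaton n) : vert A -> vert A -> Prop :=
| fold1_refl a : fold1 a a
| fold1_sym a b : fold1 a b -> fold1 b a
| fold1_trans a b c : fold1 a b -> fold1 b c -> fold1 a c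
| fold1_step a b i a' b' :
    fold1 a b -> edge a i a' -> edge b i b' -> fold1 a' b'.

Inductive fold2 n (A : automaton n) : vert A -> vert A -> Prop :=
| fold2_refl a : fold2 a a
| fold2_sym a b : fold2 a b -> fold2 b a
| fold2_trans a b c : fold2 a b -> fold2 b c -> fold2 a c
| fold2_step a b (a' b' : 'I_n -> vert A) :
    (forall i, edge a i (a' i)) -> (forall i, edge b i (b' i)) ->
    (forall i, fold2 (a' i) (b' i)) -> fold2 a b.

Section BrownThompson.
Context {R : realType} (n : nat).

Implicit Types (f g h : R -> R) (X H : set (R -> R)) (D : tree n * tree n).

Definition Zn : set R :=
  [set x | exists (k : int) (m : nat), x = k%:~R / n%:R ^+ m].

Definition homeo01 f : Prop :=
  set_bij `[0, 1] `[0, 1] f /\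
  exists g, [/\ {in `[0, 1], cancel f g}, {within `[0, 1], continuous f}
              & {within `[0, 1], continuous g}].

(* [s] contains the breakpoints of [f]: on each interval without points of [s]
   in its interior, [f] is affine with slope an integer power of [n]. *)
Definition nadic_PL f : Prop :=
  exists s : seq R, (forall c, c \in s -> Zn c) /\
    forall a b, 0 <= a -> a < b -> b <= 1 ->
      (forall c, c \in s -> ~ (a < c < b)) ->
      exists k : int, forall x, a <= x <= b -> f x = f a + n%:R ^ k * (x - a).

(* A homeomorphism of [0, 1] is represented by its extension to [R] by the
   identity. *)
Definition F : set (R -> R) :=
  [set f | [/\ forall x, x \notin `[0, 1] -> f x = x, homeo01 f & nadic_PL f]].

Definition mulF f g : R -> R := g \o f.

Definition inverse f g : Prop := cancel f g /\ cancel g f.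

Inductive generated X : set (R -> R) :=
| generated_id : generated X idfun
| generated_in f : X f -> generated X f
| generated_mul f g : generated X f -> generated X g -> generated X (mulF f g)
| generated_inv f g : generated X f -> inverse f g -> generated X g.

Definition commutators H : set (R -> R) :=
  [set c | exists f g f' g', [/\ H f, H g, inverse f f', inverse g g'
     & c = mulF (mulF (mulF f' g') f) g]].

Definition derived H : set (R -> R) := generated (commutators H).

Definition prod_set H K : set (R -> R) :=
  [set f | exists h k, [/\ H h, K k & f = mulF h k]].

Definition wval (w : word n) : R :=
  \sum_(j < size w) (nth 0%N (map val w) j)%:R / n%:R ^+ j.+1.

Definition Dtype (i : nat) : set R :=
  [set a | [/\ Zn a, 0 < a < 1 & exists w : word n, a = wval w /\ wtype w = i]].

Definition left_derivative f (a l : R) : Prop :=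
  (f x - f a) / (x - a) @[x --> a^'-] --> l.

Definition right_derivative f (a l : R) : Prop :=
  (f x - f a) / (x - a) @[x --> a^'+] --> l.

(* [f] maps each [u_j] linearly onto [v_j], with slope n^(|u_j| - |v_j|). *)
Definition represents D f : Prop :=
  [/\ is_diagram D, F f &
    forall u v, (u, v) \in branch_pairs D ->
      forall x, wval u <= x <= wval u + n%:R ^- size u ->
        f x = wval v + (x - wval u) * (n%:R ^+ size u / n%:R ^+ size v)].

Definition reduced_diagram_of X D : Prop :=
  reduced D /\ exists2 h, X h & represents D h.

(* [(D, b, w)] is the vertex [w] of the first (if [b] is [false]) or second
   (if [b] is [true]) tree of the diagram [D]. *)
Definition tree_vertex X : Type :=
  {x : (tree n * tree n) * bool * word n |
    reduced_diagram_of X x.1.1 /\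
    is_vertex (if x.1.2 then x.1.1.2 else x.1.1.1) x.2}.

(* The disjoint union of the trees of the reduced diagrams of the elements of
   [X], plus one extra vertex [None], which [glue] identifies with all the
   roots; so the root also exists when [X] is empty. *)
Definition forest X : automaton n :=
  @Automaton n (option (tree_vertex X)) None
    (fun a i b => match a, b with
       | Some x, Some y =>
           (sval x).1 = (sval y).1 /\ (sval y).2 = rcons (sval x).2 i
       | _, _ => False
       end).

Inductive glue X : vert (forest X) -> vert (forest X) -> Prop :=
| glue_root (x : tree_vertex X) : (sval x).2 = [::] -> glue None (Some x)
| glue_leaves (x y : tree_vertex X) D (u v : word n) :
    (u, v) \in branch_pairs D ->
    sval x = (D, false, u) -> sval y = (D, true, v) -> glue (Some x) (Some y).

Definition semi_core X : automaton n :=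
  let A := quotient (clos_refl_sym_trans _ (@glue X)) in
  quotient (@fold1 n A).

Definition core X : automaton n := quotient (@fold2 n (semi_core X)).

Definition accepts (A : automaton n) D : Prop :=
  forall u v, (u, v) \in branch_pairs D -> same_end A u v.

(* Cl(<X>), through the core L(X) = L(<X>). *)
Definition Cl X : set (R -> R) :=
  [set f | F f /\ exists D, represents D f /\ accepts (core X) D].

End BrownThompson.

Arguments F {R} n.

(* Main.v *)
Require Import Defs.
From Stdlib Require Import Relation_Operators.
From mathcomp Require Import all_boot all_order all_algebra.
From mathcomp Require Import all_classical all_reals all_analysis.
From mathcomp Require Import ring lra.

Set Implicit Arguments.
Unset Strict Implicit.
Unset Printing Implicit Defensive.

Import Order.TTheory GRing.Theory Num.Theory.
Import numFieldNormedType.Exports.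

Local Open Scope classical_set_scope.
Local Open Scope ring_scope.

(** Write [H] for the subgroup generated by [X], and [F'] for the derived subgroup
    of [F n]. As [H F' = F n], it suffices to show that [F'] is contained in [H].

    Reading the automata. Name every vertex of the trees by its word, and say that
    two words are linked if an element of [H] maps the interval of the first
    linearly onto that of the second. Gluing and foldings of type 1 identify
    linked words only, so words with the same end in the semi-core are linked
    ([semi_core_linked]). A folding of type 2 destroys this, but the relation that
    survives is linkage after appending any sufficiently long word
    ([core_linked]). Hence an element of the closure agrees with elements of [H] on
    the pieces of a finite n-adic subdivision ([Cl_piecewise_in]), and since
    [F n = H F'] this holds for all elements of [F n]. In particular [H] and [F n]
    have the same orbits. Moreover the elements of [F'] are trivial near 0 and 1,
    so every pair of germs of [F n] at 0 and 1 occurs in [H].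

    Compression. By the absorbing word, an interval [[u]] can be linked to
    arbitrarily short ones, and so moved by [H] into any open interval. Every
    compact interval in (0, 1) is a chain of intervals that [H] can move into
    [[u]], because some element of [F n] does so and is piecewise in [H]. An element
    of [H] shrinking a neighbourhood of 0 and trivial near 1 shows that the length
    of the chain can be bounded for all intervals at once; but if one link did not
    suffice for some interval, then arbitrarily long chains would be needed. So [H]
    moves any compact interval into any open one ([compress]).

    Patching. It follows that for every [al] the elements of [H] supported on one
    side of [al] have no common fixed point on that side, so they push everything
    there towards [al] ([push_towards_left], [push_towards_right]). The elements
    with one-sided slope [n] exist at every n-adic point, since the points of one
    type form one orbit. With them, two elements of [H] that agree at an n-adic
    point can be replaced by a single one that agrees with the first on the left
    and the second on the right ([patch]). Hence every element of [F n] agrees on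
    any compact part of (0, 1) with an element of [H] ([locally_all]).

    Commutators. For two elements of [F n] with support in a compact part of
    (0, 1), such local realizations can be chosen so that their commutator is
    exactly the given one ([commutator_in]). Finally [F'] is generated by such
    commutators: conjugation by a map that squeezes (0, 1) into a compact part of
    itself and is the identity on the support of a given element of [F'] moves the
    commutators but not that element ([derived_in]). *)

(** * Arithmetic of Z[1/n] *)

Section Arithmetic.
Context {R : realType} (n : nat) (n_ge2 : (2 <= n)%N).
Local Notation N := (n%:R : R).
Local Notation Zn := (@Zn R n).

Lemma base_gt0 : 0 < N.
Proof. by rewrite ltr0n (ltn_trans _ n_ge2). Qed.

Lemma base_neq0 : N != 0.
Proof. by rewrite gt_eqF // base_gt0. Qed.

Lemma base_gt1 : 1 < N.
Proof. by rewrite ltr1n. Qed.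

Lemma base_expz_gt0 (k : int) : 0 < N ^ k.
Proof. exact/exprz_gt0/base_gt0. Qed.

Lemma base_expz_inj (k l : int) : N ^ k = N ^ l -> k = l.
Proof.
apply: (@ieexprIz _ N) => //; first exact: base_gt0.
by rewrite gt_eqF // base_gt1.
Qed.

Lemma base_expzD (k l : int) : N ^ (k + l) = N ^ k * N ^ l.
Proof. exact: expfzDr base_neq0. Qed.

Lemma base_sub1 : (n.-1)%:R = N - 1.
Proof. by rewrite -subn1 natrB // (ltn_trans _ n_ge2). Qed.

Lemma base_sub1_gt0 : 0 < (n.-1)%:R :> R.
Proof. by rewrite base_sub1 subr_gt0 base_gt1. Qed.

Lemma Zn_int (k : int) : Zn k%:~R.
Proof. by exists k, 0%N; rewrite expr0 divr1. Qed.

Lemma Zn_nat (k : nat) : Zn k%:R.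
Proof. exact: (Zn_int k%:Z). Qed.

Lemma Zn0 : Zn 0. Proof. exact: (Zn_nat 0). Qed.

Lemma Zn1 : Zn 1. Proof. exact: (Zn_nat 1). Qed.

Lemma ZnN x : Zn x -> Zn (- x).
Proof. by move=> [k [m ->]]; exists (- k), m; rewrite mulrNz mulNr. Qed.

Lemma ZnD x y : Zn x -> Zn y -> Zn (x + y).
Proof.
move=> [k [m ->]] [l [p ->]].
exists (k * (n ^ p)%N + l * (n ^ m)%N), (m + p)%N.
rewrite intrD !intrM -!pmulrn !natrX exprD.
by field; rewrite !expf_neq0 ?base_neq0.
Qed.

Lemma ZnB x y : Zn x -> Zn y -> Zn (x - y).
Proof. by move=> Zx Zy; apply: ZnD => //; apply: ZnN. Qed.

Lemma ZnM x y : Zn x -> Zn y -> Zn (x * y).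
Proof.
move=> [k [m ->]] [l [p ->]]; exists (k * l), (m + p)%N.
by rewrite intrM exprD; field; rewrite !expf_neq0 ?base_neq0.
Qed.

Lemma Zn_expz (k : int) : Zn (N ^ k).
Proof.
case: k => k; first by rewrite -exprnP -natrX; exact: Zn_nat.
by rewrite NegzE; exists 1, k.+1; rewrite -exprnN div1r.
Qed.

(** Two points of Z[1/n] are related when their difference lies in the ideal
    generated by [n - 1]; since [n = 1] modulo that ideal, the quotient is
    Z/(n-1) and the class of [wval w] is the type of [w]. *)
Definition cong (x y : R) : Prop := Zn ((x - y) / (n.-1)%:R).

Lemma cong_refl x : cong x x.
Proof. by rewrite /cong subrr mul0r; exact: Zn0. Qed.

Lemma cong_sym x y : cong x y -> cong y x.
Proof. by move=> /ZnN; rewrite /cong -mulNr opprB. Qed.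

Lemma cong_trans y x z : cong x y -> cong y z -> cong x z.
Proof.
move=> xy yz; have := ZnD xy yz; rewrite /cong -mulrDl.
by have -> : x - y + (y - z) = x - z by ring.
Qed.

Lemma congD x y z t : cong x y -> cong z t -> cong (x + z) (y + t).
Proof.
move=> xy zt; have := ZnD xy zt; rewrite /cong -mulrDl.
by have -> : x - y + (z - t) = x + z - (y + t) by ring.
Qed.

Lemma congN x y : cong x y -> cong (- x) (- y).
Proof.
by move=> /ZnN; rewrite /cong -mulNr opprB opprK [- x + y]addrC.
Qed.

Lemma congB x y z t : cong x y -> cong z t -> cong (x - z) (y - t).
Proof. by move=> xy /congN; exact: congD. Qed.

Lemma cong_mul (x : R) : Zn x -> cong ((n.-1)%:R * x) 0.
Proof.
by move=> Zx; rewrite /cong subr0 mulrC mulKf // gt_eqF // base_sub1_gt0.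
Qed.

Lemma cong_expn (k : nat) : cong (N ^+ k) 1.
Proof.
rewrite /cong base_sub1 subrX1 mulrC mulKf; last first.
  by rewrite subr_eq0 gt_eqF // base_gt1.
elim/big_ind: _ => [||i _]; [exact: Zn0|exact: ZnD|].
exact: (Zn_expz i).
Qed.

Lemma cong_scale (k : int) x : Zn x -> cong (N ^ k * x) x.
Proof.
move=> Zx; suff H (m : nat) y : Zn y -> cong (N ^+ m * y) y.
  case: k => k; first exact: H.
  have Zy : Zn (N ^ (Negz k) * x) by apply: ZnM => //; exact: Zn_expz.
  apply: cong_sym; have := H k.+1 _ Zy.
  rewrite NegzE -exprnN mulrA mulfV ?mul1r //.
  by rewrite expf_neq0 ?base_neq0.
move=> Zy; have := ZnM (cong_expn m) Zy.
by rewrite /cong mulrAC mulrBl mul1r.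
Qed.

Lemma small_expn (e : R) : 0 < e -> exists m : nat, N ^- m < e.
Proof.
move=> e0; exists (Num.bound e^-1).
rewrite invf_plt ?posrE ?exprn_gt0 ?base_gt0 //.
apply: lt_le_trans (archi_boundP _) _; first by rewrite invr_ge0 ltW.
by rewrite -natrX ler_nat ltnW // ltn_expl.
Qed.

Lemma dense_cong (p q z : R) : p < q -> Zn z ->
  exists x, [/\ Zn x, cong x z & p < x < q].
Proof.
move=> pq Zz.
have [|m hm] := @small_expn ((q - p) / (n.-1)%:R).
  by rewrite divr_gt0 ?base_sub1_gt0 // subr_gt0.
set d := (n.-1)%:R * N ^- m.
have d0 : 0 < d by rewrite mulr_gt0 ?base_sub1_gt0 ?invr_gt0 ?exprn_gt0 ?base_gt0.
have dpq : d < q - p by rewrite /d mulrC -ltr_pdivlMr // base_sub1_gt0.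
set j := Num.floor ((p - z) / d) + 1.
have Zj : Zn (j%:~R * N ^- m).
  by apply: ZnM; [exact: Zn_int | rewrite exprnN; exact: Zn_expz].
have jE : (n.-1)%:R * (j%:~R * N ^- m) = j%:~R * d by rewrite mulrCA.
have cj := cong_mul Zj; rewrite jE in cj.
exists (z + j%:~R * d); split.
- by apply: ZnD => //; rewrite -jE; apply: ZnM => //; exact: Zn_nat.
- by have := congD (cong_refl z) cj; rewrite addr0.
- have := floorD1_gt ((p - z) / d); rewrite -/j ltr_pdivrMr // => h1.
  have := ge_floor ((p - z) / d); rewrite ler_pdivlMr // => h2.
  have h3 : j%:~R * d = (Num.floor ((p - z) / d))%:~R * d + d.
    by rewrite /j intrD mulrDl mul1r.
  lra.
Qed.

End Arithmetic.

(** * Piecewise linear maps of the line with n-adic breakpoints *)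

Section PiecewiseLinear.
Context {R : realType} (n : nat) (n_ge2 : (2 <= n)%N).
Local Notation N := (n%:R : R).
Local Notation Zn := (@Zn R n).
Implicit Types (f g h : R -> R) (s : seq R).

Definition unbroken s (x y : R) : Prop := forall c, c \in s -> ~ (x < c < y).

(** Passage from the pieces to the whole interval, for every property that is
    inherited by the union of two intervals meeting at a point of [s]. *)
Lemma interval_split_ind s (lo hi : R) (Q : R -> R -> Prop) :
  (forall x y, lo <= x -> x < y -> y <= hi -> unbroken s x y -> Q x y) ->
  (forall x c y, lo <= x -> x < c -> c < y -> y <= hi -> c \in s ->
     Q x c -> Q c y -> Q x y) ->
  forall x y, lo <= x -> x < y -> y <= hi -> Q x y.
Proof.
elim: s => [|c s IH] base step; first by move=> x y lox xy yhi; apply: base.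
apply: IH => [x y lox xy yhi free_s|x d y lox xd dy yhi ds]; last first.
  by apply: step => //; rewrite in_cons ds orbT.
have free_cons a b : x <= a -> b <= y -> ~ (a < c < b) -> unbroken (c :: s) a b.
  move=> xa yb nc d; rewrite in_cons => /orP[/eqP -> //|ds] /andP[ad db].
  by apply: (free_s _ ds); rewrite (le_lt_trans xa ad) (lt_le_trans db yb).
have [/andP[xc cy]|/negP nc] := boolP (x < c < y); last first.
  by apply: base => //; apply: free_cons.
apply: (step x c y) => //; first by rewrite mem_head.
- apply: base => //; first by rewrite (le_trans (ltW cy)).
  by apply: free_cons => //; [exact: ltW|rewrite ltxx andbF].
- apply: base => //; first by rewrite (le_trans lox) // ltW.
  by apply: free_cons => //; [exact: ltW|rewrite ltxx].
Qed.

Definition piecewise_linear f : Prop :=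
  exists s, (forall c, c \in s -> Zn c) /\
    forall a b, a < b -> unbroken s a b ->
      exists k : int, forall x, a <= x <= b -> f x = f a + N ^ k * (x - a).

(** The elements of [F n] are the maps of this group that are the identity
    outside [0, 1]. Affine maps and conjugators live in the larger group, where
    gluing needs no care at the end points. The last clause excludes translations
    by numbers that are not n-adic. *)
Definition PLn f : Prop :=
  [/\ exists g, inverse f g, piecewise_linear f & exists2 x, Zn x & Zn (f x)].

Lemma linear_increasing (k : int) (a x y : R) f :
  (forall x, a <= x <= y -> f x = f a + N ^ k * (x - a)) -> a <= x -> x < y ->
  f x < f y.
Proof.
move=> fE ax xy; rewrite (fE x) ?(fE y) ?lexx ?(ltW xy) ?ax ?(le_trans ax (ltW xy)) //.
by rewrite ltrD2l ltr_pM2l ?base_expz_gt0 // ltrD2r.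
Qed.

Lemma PLn_homo f x y : PLn f -> x < y -> f x < f y.
Proof.
move=> [_ [s [_ fs]] _] xy.
apply: (@interval_split_ind s x y (fun x y => f x < f y)) => //.
- move=> a b _ ab _ /(fs _ _ ab)[k fE]; exact: (linear_increasing fE).
- by move=> a c b _ _ _ _ _; exact: lt_trans.
Qed.

Lemma PLn_lt f : PLn f -> {mono f : x y / x < y}.
Proof.
move=> pf; apply: leW_mono; apply: le_mono => x y; exact: PLn_homo.
Qed.

Lemma PLn_le f : PLn f -> {mono f : x y / x <= y}.
Proof. by move=> pf; apply: le_mono => x y; exact: PLn_homo. Qed.

Lemma PLn_inj f : PLn f -> injective f.
Proof. by move=> /PLn_le; exact: inc_inj. Qed.

(** Slopes are powers of [n] and breakpoints are n-adic, so the invariance of one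
    n-adic point propagates along the pieces. *)
Lemma PLn_Zn_iff f x : PLn f -> Zn (f x) <-> Zn x.
Proof.
move=> pf; have [_ [s [Zs fs]] [z Zz Zfz]] := pf.
have up a b : a < b -> (Zn a -> Zn (f a) -> Zn b <-> Zn (f b)) /\
    (Zn b -> Zn (f b) -> Zn a <-> Zn (f a)).
  move=> ab.
  apply: (@interval_split_ind s a b (fun a b =>
     (Zn a -> Zn (f a) -> Zn b <-> Zn (f b)) /\
     (Zn b -> Zn (f b) -> Zn a <-> Zn (f a)))) => //.
  - move=> {}a {}b _ {}ab _ /(fs _ _ ab)[k fE].
    have fbE : f b = f a + N ^ k * (b - a) by apply: fE; rewrite lexx ltW.
    have baE : b = a + N ^ (- k) * (f b - f a).
      rewrite fbE [f a + _]addrC addrK mulrA -base_expzD // addNr mul1r.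
      by rewrite addrC subrK.
    split=> Za Zfa; split.
    + move=> Zb; rewrite fbE; apply: ZnD => //; apply: ZnM => //; last exact: ZnB.
      exact: Zn_expz.
    + move=> Zb; rewrite baE; apply: ZnD => //; apply: ZnM => //; last exact: ZnB.
      exact: Zn_expz.
    + move=> Zb; have -> : f a = f b - N ^ k * (b - a) by rewrite fbE addrK.
      apply: ZnB => //; apply: ZnM => //; last exact: ZnB.
      exact: Zn_expz.
    + move=> Zb; have -> : a = b - N ^ (- k) * (f b - f a) by rewrite {1}baE addrK.
      apply: ZnB => //; apply: ZnM => //; last exact: ZnB.
      exact: Zn_expz.
  - move=> x1 c y1 _ _ _ _ /Zs Zc [h1 h2] [h3 h4]; split => Zx Zfx.
    + by apply: h3 => //; apply/h1.
    + by apply: h2 => //; apply/h4.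
case: (ltgtP z x) => [/up[h _]|/up[_ h]|<-] => //.
- by rewrite h.
- by rewrite h.
Qed.

Lemma PLn_id : PLn idfun.
Proof.
split; first by exists idfun.
- exists [::]; split => // a b _ _; exists 0 => x _.
  by rewrite expr0z mul1r addrC subrK.
- by exists 0; exact: Zn0.
Qed.

Lemma inverse_sym f g : inverse f g -> inverse g f.
Proof. by case. Qed.

Lemma inverse_comp f f' g g' :
  inverse f f' -> inverse g g' -> inverse (g \o f) (f' \o g').
Proof.
by move=> [fK fK'] [gK gK']; split=> x /=; rewrite ?gK ?fK // ?fK' ?gK'.
Qed.

Lemma PLn_inv f g : PLn f -> inverse f g -> PLn g.
Proof.
move=> pf [fK gK]; split; first by exists f.
- have [_ [s [Zs fs]] _] := pf.
  exists [seq f c | c <- s]; split=> [_ /mapP[c /Zs Zc ->]|a b ab fr].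
    by apply/PLn_Zn_iff.
  have gab : g a < g b by rewrite -(PLn_lt pf) !gK.
  have [c cs cab|k fE] := fs _ _ gab.
    apply: (fr (f c)); first by apply/mapP; exists c.
    by rewrite -(gK a) -(gK b) !(PLn_lt pf).
  exists (- k) => x xab.
  have := fE (g x); rewrite -[g a <= _](PLn_le pf) -[_ <= g b](PLn_le pf) !gK => /(_ xab) xE.
  have -> : x - a = N ^ k * (g x - g a) by rewrite {1}xE addrC addKr.
  by rewrite mulrA -base_expzD // addNr mul1r addrC subrK.
- have [_ _ [x Zx Zfx]] := pf; exists (f x) => //; by rewrite fK.
Qed.

Lemma PLn_comp f g : PLn f -> PLn g -> PLn (g \o f).
Proof.
move=> pf pg; have [[f' [fK f'K]] [s [Zs fs]] [x Zx Zfx]] := pf.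
have [[g' [gK g'K]] [t [Zt gt]] _] := pg.
split.
- by exists (f' \o g'); apply: inverse_comp.
- exists (s ++ [seq f' c | c <- t]); split=> [c|a b ab fr].
    rewrite mem_cat => /orP[/Zs //|/mapP[d /Zt Zd ->]].
    by rewrite -(PLn_Zn_iff _ pf) f'K.
  have [c cs|k fE] := fs _ _ ab; first by apply: fr; rewrite mem_cat cs.
  have [c ct cab|l gE] := gt (f a) (f b) (PLn_homo pf ab).
    apply: (fr (f' c)); first by rewrite mem_cat map_f ?orbT.
    by rewrite -[a < _](PLn_lt pf) -[_ < b](PLn_lt pf) f'K.
  exists (k + l) => z zab /=.
  rewrite gE ?(PLn_le pf) // (fE z) // [f a + _]addrC addrK mulrA.
  by rewrite base_expzD // [N ^ k * _]mulrC.
- by exists x => //=; apply/PLn_Zn_iff.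
Qed.

Lemma PLn_affine (k : int) (c : R) : Zn c -> PLn (fun x => N ^ k * x + c).
Proof.
move=> Zc; split.
- exists (fun x => N ^ (- k) * (x - c)); split=> x /=.
    by rewrite addrK mulrA -base_expzD // addNr mul1r.
  by rewrite mulrA -base_expzD // addrN mul1r subrK.
- exists [::]; split => // a b _ _; exists k => x _.
  by rewrite mulrBr addrCA addrAC addrA; ring.
- by exists 0; rewrite ?mulr0 ?add0r //; exact: Zn0.
Qed.

Definition glue_at (c : R) f g : R -> R := fun x => if x <= c then f x else g x.

Lemma glue_at_left c f g x : x <= c -> glue_at c f g x = f x.
Proof. by rewrite /glue_at => ->. Qed.

Lemma glue_at_right c f g x : f c = g c -> c <= x -> glue_at c f g x = g x.
Proof.
by rewrite /glue_at => fg; rewrite le_eqVlt => /orP[/eqP <-|/lt_geF ->]; rewrite ?lexx.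
Qed.

Lemma PLn_glue c f g : Zn c -> f c = g c -> PLn f -> PLn g -> PLn (glue_at c f g).
Proof.
move=> Zc fgc pf pg.
have [[f' fK] [s [Zs fs]] _] := pf; have [[g' gK] [t [Zt gt]] _] := pg.
have pf' := PLn_inv pf fK; have pg' := PLn_inv pg gK.
have [fK1 fK2] := fK; have [gK1 gK2] := gK.
split.
- exists (glue_at (f c) f' g'); split=> x.
    rewrite /glue_at; have [xc|cx] := leP x c.
      by rewrite (PLn_le pf) xc fK1.
    by rewrite fgc (PLn_le pg) leNgt cx /= gK1.
  rewrite /glue_at; have [xc|cx] := leP x (f c).
    by rewrite -{1}(fK2 x) (PLn_le pf) in xc *; rewrite xc fK2.
  by move: cx; rewrite fgc -{1}(gK2 x) (PLn_lt pg) leNgt => -> /=; rewrite gK2.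
- exists (c :: s ++ t); split=> [d|a b ab fr].
    by rewrite in_cons mem_cat => /orP[/eqP -> //|/orP[/Zs|/Zt]].
  have [cab|ca] := leP c a.
    have [d dt|k gE] := gt _ _ ab; first by apply: fr; rewrite in_cons mem_cat dt !orbT.
    exists k => x /andP[ax xb]; rewrite !glue_at_right ?(le_trans cab ax) //.
    by rewrite gE ?ax.
  have bc : b <= c.
    by rewrite leNgt; apply/negP => cb; apply: (fr c); rewrite ?mem_head // ca.
  have [d ds|k fE] := fs _ _ ab; first by apply: fr; rewrite in_cons mem_cat ds orbT.
  exists k => x /andP[ax xb]; rewrite !glue_at_left ?(ltW ca) ?(le_trans xb bc) //.
  by rewrite fE ?ax.
- by exists c => //; rewrite glue_at_left //; apply/PLn_Zn_iff.
Qed.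

End PiecewiseLinear.

(** * Elements of [F n] *)

Section Elements.
Context {R : realType} (n : nat) (n_ge2 : (2 <= n)%N).
Local Notation N := (n%:R : R).
Local Notation Zn := (@Zn R n).
Local Notation PLn := (@PLn R n).
Local Notation F := (@F R n).
Implicit Types (f g h : R -> R) (s : seq R).

Definition id_outside (p q : R) f : Prop := forall x, (x <= p) || (q <= x) -> f x = x.

(** Positive slopes make the map increasing on [0, 1]; being onto, it must then
    fix both end points, which allows the extension by the identity. *)
Lemma F_PLn_id f : F f -> PLn f /\ id_outside 0 1 f.
Proof.
move=> [fid [[fhomo finj fsurj] [g [fgK _ _]]] [s [Zs fs]]].
have f01 x : 0 <= x <= 1 -> 0 <= f x <= 1.
  by move=> x01; have := fhomo x; rewrite /= !in_itv /=; apply.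
have f_lt x y : 0 <= x -> x < y -> y <= 1 -> f x < f y.
  apply: (@interval_split_ind R s 0 1 (fun x y => f x < f y)) =>
    [a b a0 ab b1 fr|a c b _ _ _ _ _]; last exact: lt_trans.
  have [k fE] := fs a b a0 ab b1 fr; exact: (linear_increasing n_ge2 fE).
have f0 : f 0 = 0.
  have [] := fsurj 0; first by rewrite /= in_itv /= lexx ler01.
  move=> x; rewrite /= in_itv /= => /andP[]; rewrite le_eqVlt => /orP[/eqP <- //|x0] x1 fx0.
  have := f_lt 0 x (lexx _) x0 x1; rewrite fx0 ltNge.
  by have /andP[-> _] : 0 <= f 0 <= 1 by apply: f01; rewrite lexx ler01.
have f1 : f 1 = 1.
  have [] := fsurj 1; first by rewrite /= in_itv /= lexx ler01.
  move=> x; rewrite /= in_itv /= => /andP[x0]; rewrite le_eqVlt => /orP[/eqP -> //|x1] fx1.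
  have := f_lt x 1 x0 x1 (lexx _); rewrite fx1 ltNge.
  by have /andP[_ ->] : 0 <= f 1 <= 1 by apply: f01; rewrite lexx ler01.
have fid' x : (x <= 0) || (1 <= x) -> f x = x.
  move=> /orP[]; rewrite le_eqVlt => /orP[/eqP x01|x01].
  - by rewrite x01.
  - by apply: fid; rewrite in_itv /= leNgt x01.
  - by rewrite -x01.
  - by apply: fid; rewrite in_itv /= [x <= 1]leNgt x01 andbF.
split=> //; split.
- exists (fun y => if 0 <= y <= 1 then g y else y); split=> x.
    have [x01|x01] := boolP (0 <= x <= 1).
      by rewrite f01 // fgK // in_itv.
    have -> : f x = x by apply: fid; rewrite in_itv.
    by rewrite (negPf x01).
  have [x01|x01] := boolP (0 <= x <= 1); last by apply: fid; rewrite in_itv.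
  have [] := fsurj x; first by rewrite /= in_itv.
  by move=> y y01 <-; rewrite fgK.
- exists (0 :: 1 :: s); split=> [c|a b ab fr].
    by rewrite !in_cons => /orP[/eqP ->|/orP[/eqP ->|/Zs //]]; [exact: Zn0|exact: Zn1].
  have idk : (b <= 0) || (1 <= a) -> exists k : int, forall x, a <= x <= b ->
      f x = f a + N ^ k * (x - a).
    move=> ab01; exists 0 => x /andP[ax xb]; rewrite expr0z mul1r !fid'.
    - by rewrite addrC subrK.
    - by case/orP: ab01 => [b0|->]; rewrite ?orbT // (le_trans ax) // (le_trans xb).
    - by case/orP: ab01 => [b0|h]; rewrite ?(le_trans xb b0) ?(le_trans h ax) ?orbT.
  have [b0|b0] := leP b 0; first by apply: idk; rewrite b0.
  have [a1|a1] := leP 1 a; first by apply: idk; rewrite a1 orbT.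
  apply: fs => //.
  + rewrite leNgt; apply/negP => a0; apply: (fr 0); first by rewrite mem_head.
    by rewrite a0.
  + rewrite leNgt; apply/negP => b1; apply: (fr 1); first by rewrite !in_cons eqxx orbT.
    by rewrite a1.
  + by move=> c cs; apply: fr; rewrite !in_cons cs !orbT.
- by exists 0; rewrite ?f0; exact: Zn0.
Qed.

Lemma F_PLn f : F f -> PLn f.
Proof. by case/F_PLn_id. Qed.

Lemma F_id_outside f : F f -> id_outside 0 1 f.
Proof. by case/F_PLn_id. Qed.

Lemma PLn_surj_itv f (a b : R) : PLn f -> set_surj `[a, b] `[f a, f b] f.
Proof.
move=> pf y /=; rewrite in_itv /= => yab; have [[g [fK gK]] _ _] := pf.
exists (g y); rewrite ?gK //= in_itv /=.
by rewrite -[a <= _](PLn_le n_ge2 pf) -[_ <= b](PLn_le n_ge2 pf) gK.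
Qed.

Lemma PLn_F f : PLn f -> id_outside 0 1 f -> F f.
Proof.
move=> pf fid.
have f0 : f 0 = 0 by rewrite fid ?lexx.
have f1 : f 1 = 1 by rewrite fid ?lexx ?orbT.
have [[g fgK] [s [Zs fs]] _] := pf; have pg := PLn_inv n_ge2 pf fgK.
have [fK gK] := fgK.
have g0 : g 0 = 0 by rewrite -{1}f0 fK.
have g1 : g 1 = 1 by rewrite -{1}f1 fK.
split.
- by move=> x; rewrite in_itv /= negb_and -!ltNge => /orP[h|h]; apply: fid; rewrite (ltW h) ?orbT.
- have cont h : PLn h -> h 0 = 0 -> h 1 = 1 -> {within `[0, 1], continuous h}.
    move=> ph h0 h1; apply: segment_inc_surj_continuous; last exact: PLn_surj_itv.
    by move=> x y _ _; exact: (PLn_le n_ge2 ph).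
  split; last by exists g; split=> [x _||]; [exact: fK|exact: cont|exact: cont].
  split; last by have := @PLn_surj_itv f 0 1 pf; rewrite f0 f1.
    move=> x /=; rewrite !in_itv /= => x01.
    by rewrite -{1}f0 -{1}f1 !(PLn_le n_ge2 pf).
  by move=> x y _ _; exact: (PLn_inj n_ge2 pf).
- exists s; split=> // a b _ ab _ fr; exact: (fs a b ab fr).
Qed.

Lemma F_id : F idfun.
Proof. by apply: PLn_F => // ; exact: PLn_id. Qed.

Lemma F_comp f g : F f -> F g -> F (g \o f).
Proof.
move=> Ff Fg; apply: PLn_F; first by apply: PLn_comp; rewrite //; exact: F_PLn.
by move=> x x01 /=; rewrite (F_id_outside Ff) // (F_id_outside Fg).
Qed.

Lemma F_inv f g : F f -> inverse f g -> F g.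
Proof.
move=> Ff fgK; apply: PLn_F; first exact: (PLn_inv n_ge2 (F_PLn Ff)).
by move=> x x01; rewrite -{1}(F_id_outside Ff x01) (proj1 fgK).
Qed.

Lemma F_restrict g : PLn g -> g 0 = 0 -> g 1 = 1 ->
  exists2 f, F f & forall x, 0 <= x <= 1 -> f x = g x.
Proof.
move=> pg g0 g1.
have E1 : glue_at 1 g idfun 0 = 0 by rewrite glue_at_left ?g0 ?ler01.
exists (glue_at 0 idfun (glue_at 1 g idfun)); last first.
  move=> x /andP[x0 x1]; rewrite glue_at_right ?E1 //.
  by rewrite glue_at_left.
apply: PLn_F.
  apply: PLn_glue; rewrite ?E1 //; [exact: Zn0|exact: PLn_id|].
  by apply: PLn_glue => //; [exact: Zn1|exact: PLn_id].
move=> x /orP[x0|x1]; first by rewrite glue_at_left.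
rewrite glue_at_right ?E1 // ?(le_trans ler01 x1) //.
by rewrite glue_at_right.
Qed.

Lemma PLn_kink (c : R) : Zn c -> PLn (glue_at c idfun (fun x => N * x + c * (1 - N))).
Proof.
move=> Zc; apply: PLn_glue => //; first by rewrite /=; ring.
  exact: PLn_id.
apply: (@PLn_affine R n n_ge2 1); apply: ZnM => //.
by apply: ZnB => //; [exact: Zn1|exact: Zn_nat].
Qed.

(** A kink of slope [n] at the last unit cell lengthens that cell from 1 to [n]. *)
Lemma stretch (p j : nat) : (0 < p)%N ->
  exists g, [/\ PLn g, g 0 = 0 & g p%:R = (p + j * n.-1)%:R].
Proof.
move=> p0; elim: j => [|j [g [pg g0 gp]]].
  by exists idfun; rewrite mul0n addn0; split=> //; exact: PLn_id.
set q := (p + j * n.-1)%N in gp *; have q0 : (0 < q)%N by rewrite /q addn_gt0 p0.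
have ZC : Zn (q.-1)%:R by exact: Zn_nat.
exists (glue_at (q.-1)%:R idfun (fun x => N * x + (q.-1)%:R * (1 - N)) \o g).
split=> /=.
- by apply: PLn_comp => //; exact: PLn_kink.
- by rewrite g0 glue_at_left.
- rewrite gp glue_at_right; last 2 first.
  + by rewrite /=; ring.
  + by rewrite ler_nat leq_pred.
  rewrite mulSn addnCA natrD -/q base_sub1 //.
  have -> : (q.-1)%:R = q%:R - 1 :> R by rewrite -subn1 natrB.
  by ring.
Qed.

Lemma Zn_denominator (x : R) : Zn x ->
  exists m : nat, forall m', (m <= m')%N -> exists k : int, x = k%:~R / N ^+ m'.
Proof.
move=> [k [m ->]]; exists m => m' mm'; exists (k * (n ^ (m' - m))%N).
rewrite -{2}(subnKC mm') exprD intrM -pmulrn natrX.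
by field; rewrite !expf_neq0 ?base_neq0.
Qed.

(** The congruence is exactly what allows [a, b] and [c, d] to be cut into
    equally many cells: cutting one cell into [n] smaller ones adds [n - 1]. *)
Lemma interpolate (a b c d : R) : Zn a -> Zn b -> Zn c -> Zn d -> a < b -> c < d ->
  cong n (b - a) (d - c) -> exists g, [/\ PLn g, g a = c & g b = d].
Proof.
move=> Za Zb Zc Zd ab cd cg.
have [m1 H1] := Zn_denominator (ZnB n_ge2 Zb Za).
have [m2 H2] := Zn_denominator (ZnB n_ge2 Zd Zc).
have [m3 H3] := Zn_denominator cg.
set m := maxn m1 (maxn m2 m3).
have [k1 E1] := H1 m (leq_maxl _ _).
have [k2 E2] := H2 m (leq_trans (leq_maxl _ _) (leq_maxr _ _)).
have [k3 E3] := H3 m (leq_trans (leq_maxr _ _) (leq_maxr _ _)).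
have M0 : 0 < N ^+ m by rewrite exprn_gt0 // base_gt0.
have k1_gt0 : 0 < k1.
  have : 0 < b - a by rewrite subr_gt0.
  by rewrite E1 pmulr_lgt0 ?invr_gt0 // ltr0z.
have k2_gt0 : 0 < k2.
  have : 0 < d - c by rewrite subr_gt0.
  by rewrite E2 pmulr_lgt0 ?invr_gt0 // ltr0z.
have k12 : k1 - k2 = k3 * (n.-1)%:Z.
  apply: (@intr_inj R); rewrite intrB intrM.
  have := E3; rewrite E1 E2 => /(congr1 (fun x => x * (n.-1)%:R * N ^+ m)).
  rewrite -pmulrn divfK ?gt_eqF ?base_sub1_gt0 //.
  rewrite mulrBl !divfK ?gt_eqF // => ->.
  by rewrite mulrAC divfK ?gt_eqF // mulrC.
have [g [pg g0 gp]] : exists g, [/\ PLn g, g 0 = 0 & g k1%:~R = k2%:~R].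
  case: k1 k2 k3 k1_gt0 k2_gt0 k12 {E1 E2 E3} => // k1 [] // k2 k3 k1_gt0 k2_gt0 k12.
  case: k3 k12 => k3 k12.
    have [g [pg g0 gp]] := stretch k3 k2_gt0; have [[g' gK] _ _] := pg.
    have pg' := PLn_inv n_ge2 pg gK; exists g'; split=> //.
      by rewrite -{1}g0 (proj1 gK).
    have -> : k1 = (k2 + k3 * n.-1)%N.
      by apply/eqP; rewrite -eqz_nat PoszD PoszM -k12 addrC subrK.
    by rewrite -!pmulrn -gp (proj1 gK).
  have [g [pg g0 gp]] := stretch k3.+1 k1_gt0; exists g; split=> //.
  have -> : k2 = (k1 + k3.+1 * n.-1)%N.
    apply/eqP; rewrite -eqz_nat PoszD PoszM.
    by move: k12; rewrite NegzE mulNr => k12; rewrite -[(_ * _)%R]opprK -k12; apply/eqP; ring.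
  by rewrite -!pmulrn gp.
exists ((fun x => N ^ (- m%:Z) * x + c) \o g \o (fun x => N ^ m * x + - (N ^ m * a))).
split=> /=.
- apply: PLn_comp => //; first apply: PLn_affine => //.
    by apply: ZnN; apply: ZnM => //; exact: Zn_expz.
  by apply: PLn_comp => //; exact: PLn_affine.
- by rewrite subrr g0 mulr0 add0r.
- have -> : N ^ m * b + - (N ^ m * a) = k1%:~R.
    by rewrite -mulrBr E1 -exprnP mulrC divfK ?gt_eqF.
  by rewrite gp -exprnN mulrC -E2 subrK.
Qed.

End Elements.

(** * Germs and slopes at the end points *)

Section Germs.
Context {R : realType} (n : nat) (n_ge2 : (2 <= n)%N).
Local Notation N := (n%:R : R).
Local Notation Zn := (@Zn R n).
Local Notation PLn := (@PLn R n).
Local Notation F := (@F R n).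
Implicit Types (f g h : R -> R) (s : seq R).

Lemma F_three (a b : R) g1 g3 : PLn g1 -> PLn g3 -> g1 0 = 0 -> g3 1 = 1 ->
  Zn a -> Zn b -> 0 <= a -> a < b -> b <= 1 -> g1 a < g3 b ->
  cong n (b - a) (g3 b - g1 a) ->
  exists f, [/\ F f, forall x, 0 <= x <= a -> f x = g1 x
                & forall x, b <= x <= 1 -> f x = g3 x].
Proof.
move=> p1 p3 g10 g31 Za Zb a0 ab b1 g13 cg.
have Zga : Zn (g1 a) by apply/PLn_Zn_iff.
have Zgb : Zn (g3 b) by apply/PLn_Zn_iff.
have [g2 [p2 g2a g2b]] := interpolate n_ge2 Za Zb Zga Zgb ab g13 cg.
have E : glue_at b g2 g3 a = g1 a by rewrite glue_at_left ?ltW.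
have [||| f Ff fE] := @F_restrict R n n_ge2 (glue_at a g1 (glue_at b g2 g3)).
- by apply: PLn_glue => //; apply: PLn_glue.
- by rewrite glue_at_left.
- have ab1 := le_trans (ltW ab) b1.
  by rewrite glue_at_right ?E // glue_at_right.
exists f; split=> // x /andP[h1 h2].
- by rewrite fE ?h1 ?(le_trans h2 (le_trans (ltW ab) b1)) // glue_at_left.
- rewrite fE ?h2 ?(le_trans a0 (le_trans (ltW ab) h1)) //.
  by rewrite glue_at_right ?E ?(le_trans (ltW ab)) // glue_at_right.
Qed.

Lemma F_move (a b : R) : Zn a -> Zn b -> 0 < a < 1 -> 0 < b < 1 -> cong n a b ->
  exists2 f, F f & f a = b.
Proof.
move=> Za Zb /andP[a0 a1] /andP[b0 b1] ab.
have [|g1 [p1 g10 g1a]] := interpolate n_ge2 (Zn0 n) Za (Zn0 n) Zb a0 b0.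
  by rewrite !subr0.
have [|g2 [p2 g2a g21]] := interpolate n_ge2 Za (Zn1 n) Zb (Zn1 n) a1 b1.
  by apply: congB => //; exact: cong_refl.
have [||| f Ff fE] := @F_restrict R n n_ge2 (glue_at a g1 g2).
- by apply: PLn_glue; rewrite // g1a.
- by rewrite glue_at_left // ltW.
- by rewrite glue_at_right ?g1a // ltW.
by exists f => //; rewrite fE ?(ltW a0) ?(ltW a1) // glue_at_left.
Qed.

Lemma F_compress (a b l e : R) : 0 < a -> a < b -> b < 1 -> 0 <= l -> l < e -> e <= 1 ->
  exists f, [/\ F f, l < f a & f b < e].
Proof.
move=> a0 ab b1 l0 le e1.
have [m lm me] : exists2 m, l < m & m < e.
  by exists ((l + e) / 2); [rewrite midf_lt|rewrite midf_lt].
have [a' [Za' ca' /andP[a'0 a'a]]] := dense_cong n_ge2 a0 (Zn0 n).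
have [b' [Zb' cb' /andP[bb' b'1]]] := dense_cong n_ge2 b1 (Zn0 n).
have [l' [Zl' cl' /andP[ll' l'm]]] := dense_cong n_ge2 lm (Zn0 n).
have [e' [Ze' ce' /andP[me' e'e]]] := dense_cong n_ge2 me (Zn0 n).
have l'0 : 0 < l' by rewrite (le_lt_trans l0).
have e'1 : e' < 1 by rewrite (lt_le_trans e'e).
have c0 (x y : R) : cong n x 0 -> cong n y 0 -> cong n x y.
  by move=> cx /cong_sym; exact: cong_trans.
have [|g1 [p1 g10 g1a]] := interpolate n_ge2 (Zn0 n) Za' (Zn0 n) Zl' a'0 l'0.
  by rewrite !subr0; exact: c0.
have [|g3 [p3 g3b g31]] := interpolate n_ge2 Zb' (Zn1 n) Ze' (Zn1 n) b'1 e'1.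
  by apply: congB; [|exact: cong_refl|exact: c0].
have a'b' : a' < b' by rewrite (lt_trans a'a) // (lt_trans ab).
have [||||f [Ff fl fr]] := F_three p1 p3 g10 g31 Za' Zb' _ a'b'; rewrite ?ltW //.
- by rewrite g1a g3b (lt_trans l'm).
- by rewrite g1a g3b; apply: congB => //; exact: c0.
have f_lt := PLn_lt n_ge2 (F_PLn n_ge2 Ff).
exists f; split=> //.
- by rewrite (lt_trans ll') // -g1a -fl ?f_lt // (ltW a'0) lexx.
- by rewrite (lt_trans _ e'e) // -g3b -fr ?f_lt // (ltW b'1) lexx.
Qed.

(** The direction [d] is [1] for the germ on the right of [p] and [-1] for the
    germ on the left, so that both sides are handled at once. *)
Definition germ (d : R) f (p : R) (k : int) : Prop :=
  exists2 e, 0 < e & forall t, 0 <= t <= e -> f (p + d * t) = f p + d * (N ^ k * t).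

Lemma germ_exists d f p : d * d = 1 -> PLn f -> exists k, germ d f p k.
Proof.
move=> dd [_ [s [_ fs]] _].
have [e e0 He] : exists2 e, 0 < e & forall c, c \in s -> ~ (0 < d * (c - p) < e).
  elim: s {fs} => [|c s [e e0 IH]]; first by exists 1.
  have [c0|c0] := ltP 0 (d * (c - p)); last first.
    exists e => // x; rewrite in_cons => /orP[/eqP ->|/IH //].
    by rewrite ltNge c0.
  exists (Num.min e (d * (c - p))); first by rewrite lt_min e0.
  move=> x; rewrite in_cons => /orP[/eqP ->|/IH h].
    by rewrite lt_min ltxx !andbF.
  by rewrite lt_min => /and3P[h1 h2 _]; apply: h; rewrite h1.
have [d1|d1] : d = 1 \/ d = -1.
  by have /eqP := dd; rewrite -expr2 sqrf_eq1 => /orP[] /eqP; [left|right].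
- have [||k fE] := fs p (p + e); first by rewrite ltrDl.
    move=> c /He h /andP[pc ce]; apply: h; rewrite d1 mul1r subr_gt0 pc.
    by rewrite ltrBlDl.
  exists k, e => // t /andP[t0 te]; rewrite d1 !mul1r fE ?lerDl ?t0 ?lerD2l //.
  by rewrite [p + t]addrC addrK.
- have [||k fE] := fs (p - e) p; first by rewrite ltrBlDr ltrDl.
    move=> c /He h /andP[pc ce]; apply: h; rewrite d1 mulN1r opprB subr_gt0 ce.
    by rewrite ltrBlDr addrC -ltrBlDr.
  exists k, e => // t /andP[t0 te]; rewrite d1 !mulN1r.
  rewrite (fE (p - t)) ?(fE p) ?lexx ?lerD2l ?lerN2 ?te ?gerBl ?t0 ?(ltW e0) //.
  by ring.
Qed.

Lemma germ_comp d f g p k l :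
  germ d f p k -> germ d g (f p) l -> germ d (g \o f) p (k + l).
Proof.
move=> [e e0 fE] [e' e'0 gE].
exists (Num.min e (N ^ (- k) * e')).
  by rewrite lt_min e0 mulr_gt0 ?base_expz_gt0.
move=> t; rewrite le_min => /and3P[t0 te te'] /=; rewrite fE ?t0 // gE.
  by rewrite base_expzD // mulrA [N ^ l * _]mulrC.
rewrite mulr_ge0 ?(ltW (base_expz_gt0 n_ge2 _)) //=.
by rewrite -(ler_pM2l (base_expz_gt0 n_ge2 (- k))) mulrA -base_expzD // addNr mul1r.
Qed.

Lemma germ_inv d f g p k : germ d f p k -> inverse f g -> germ d g (f p) (- k).
Proof.
move=> [e e0 fE] [fK gK]; exists (N ^ k * e).
  by rewrite mulr_gt0 ?base_expz_gt0.
move=> t /andP[t0 te].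
have -> : t = N ^ k * (N ^ (- k) * t) by rewrite mulrA -base_expzD // addrN mul1r.
rewrite -fE ?fK; last first.
  rewrite mulr_ge0 ?(ltW (base_expz_gt0 n_ge2 _)) //=.
  by rewrite -(ler_pM2l (base_expz_gt0 n_ge2 k)) mulrA -base_expzD // addrN mul1r.
by rewrite mulrA [N ^ (- k) * N ^ k]mulrC -mulrA [N ^ k * (_ * _)]mulrA -base_expzD // addrN mul1r.
Qed.

Lemma germ_id d p : germ d idfun p 0.
Proof. by exists 1 => // t _; rewrite expr0z mul1r. Qed.

Definition fix_near_ends f : Prop :=
  exists2 e, 0 < e & forall x, (x <= e) || (1 - e <= x) -> f x = x.

Lemma germ_fix_near_ends f : F f -> germ 1 f 0 0 -> germ (-1) f 1 0 ->
  fix_near_ends f.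
Proof.
move=> Ff [e e0 fE] [e' e'0 fE'].
exists (Num.min e e'); first by rewrite lt_min e0.
have f0 : f 0 = 0 by rewrite (F_id_outside n_ge2 Ff) ?lexx.
have f1 : f 1 = 1 by rewrite (F_id_outside n_ge2 Ff) ?lexx ?orbT.
move=> x; rewrite le_min => /orP[/andP[xe _]|h].
  have [x0|x0] := leP x 0; first by rewrite (F_id_outside n_ge2 Ff) ?x0.
  have := fE x; rewrite expr0z !mul1r f0 !add0r (ltW x0) xe.
  by apply.
have {h} xe : 1 - e' <= x.
  by apply: le_trans h; rewrite lerD2l lerN2 ge_min lexx orbT.
have [x1|x1] := leP 1 x; first by rewrite (F_id_outside n_ge2 Ff) ?x1 ?orbT.
have := fE' (1 - x); rewrite expr0z mul1r !mulN1r f1 opprB addrCA subrr addr0; apply.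
by rewrite subr_ge0 ltW // lerBlDr addrC -lerBlDr.
Qed.

(** Slopes at the end points are homomorphisms to an abelian group. *)
Lemma commutator_fix_near_ends f g f' g' : F f -> F g -> inverse f f' ->
  inverse g g' -> fix_near_ends (g \o (f \o (g' \o f'))).
Proof.
move=> Ff Fg If Ig; have Ff' := F_inv n_ge2 Ff If; have Fg' := F_inv n_ge2 Fg Ig.
have pf := F_PLn n_ge2 Ff; have pg := F_PLn n_ge2 Fg.
have fixE h p : F h -> p = 0 \/ p = 1 -> h p = p.
  by move=> Fh [] ->; rewrite (F_id_outside n_ge2 Fh) ?lexx ?orbT.
have H d p : d * d = 1 -> p = 0 \/ p = 1 -> germ d (g \o (f \o (g' \o f'))) p 0.
  move=> dd p01.
  have [k fk] := germ_exists p dd pf; have [l gl] := germ_exists p dd pg.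
  have fk' := germ_inv fk If; have gl' := germ_inv gl Ig.
  rewrite (fixE f) // in fk'; rewrite (fixE g) // in gl'.
  rewrite [X in germ _ _ _ X](_ : _ = (- k + - l) + k + l); last by ring.
  apply: germ_comp; last by rewrite /= (fixE f') // (fixE g') // (fixE f).
  apply: germ_comp; last by rewrite /= (fixE f') // (fixE g').
  by apply: germ_comp => //; rewrite (fixE f').
apply: germ_fix_near_ends; [|exact: H (mul1r _) (or_introl _)|].
  by apply: F_comp Fg => //; apply: F_comp Ff => //; exact: F_comp.
by apply: H; [rewrite mulrNN mul1r|right].
Qed.

Lemma derived_F_fix f : derived F f -> F f /\ fix_near_ends f.
Proof.
elim=> {f} [|_ [f [g [f' [g' [Ff Fg If Ig ->]]]]]|f g _ [Ff [e e0 fE]] _ [Fg [e' e'0 gE]]|].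
- by split; [exact: F_id|exists 1].
- split; last exact: commutator_fix_near_ends.
  have Ff' := F_inv n_ge2 Ff If; have Fg' := F_inv n_ge2 Fg Ig.
  by apply: F_comp Fg => //; apply: F_comp Ff => //; exact: F_comp.
- split; first exact: F_comp.
  exists (Num.min e e'); first by rewrite lt_min e0.
  move=> x h.
  have h1 : (x <= e) || (1 - e <= x).
    case/orP: h => [|h]; first by rewrite le_min => /andP[->].
    by rewrite (le_trans _ h) ?orbT // lerD2l lerN2 ge_min lexx.
  have h2 : (x <= e') || (1 - e' <= x).
    case/orP: h => [|h]; first by rewrite le_min => /andP[_ ->].
    by rewrite (le_trans _ h) ?orbT // lerD2l lerN2 ge_min lexx orbT.
  by rewrite /mulF /= fE // gE.
- move=> f g _ [Ff [e e0 fE]] fg; split; first exact: (F_inv n_ge2 Ff).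
  by exists e => // x h; rewrite -{1}(fE _ h) (proj1 fg).
Qed.

(** Two affine end pieces can always be joined: multiplication by a power of [n]
    preserves congruence classes, which is the condition of [interpolate]. *)
Lemma F_end_slopes (k1 k2 : int) : (k1 = 0 \/ k1 = -1) -> (k2 = 0 \/ k2 = -1) ->
  exists f, [/\ F f, germ 1 f 0 k1 & germ (-1) f 1 k2].
Proof.
move=> k1E k2E; have half : (0 : R) < 1 / 2 by [].
have half1 : (1 / 2 : R) < 1 by lra.
have [a [Za _ /andP[a0 a1]]] := dense_cong n_ge2 half (Zn0 n).
have [b [Zb _ /andP[b0 b1]]] := dense_cong n_ge2 half1 (Zn0 n).
have slope_le (k : int) (x : R) : (k = 0 \/ k = -1) -> 0 < x -> N ^ k * x <= x.
  move=> [] -> x0; first by rewrite expr0z mul1r.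
  by rewrite exprN1 ler_piMl ?invf_le1 ?ltW ?base_gt0 ?base_gt1.
have Zc : Zn (1 - N ^ k2) by apply: ZnB => //; [exact: Zn1|exact: Zn_expz].
have ha : N ^ k1 * a <= a by exact: slope_le.
have hb : N ^ k2 * (1 - b) <= 1 - b by apply: slope_le => //; rewrite subr_gt0.
have [|||||||||||f [Ff f1 f2]] := @F_three a b (fun x => N ^ k1 * x + 0)
  (fun x => N ^ k2 * x + (1 - N ^ k2)); rewrite ?addr0 ?mulr0 ?mulr1 ?ltW //.
- by apply: PLn_affine => //; exact: Zn0.
- exact: PLn_affine.
- by rewrite addrC subrK.
- by rewrite (lt_trans a1).
- by lra.
- have -> : N ^ k2 * b + (1 - N ^ k2) - N ^ k1 * a = 1 + N ^ k2 * (b - 1) - N ^ k1 * a by ring.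
  apply: congB => //; last by apply: cong_sym; apply: cong_scale.
  have cb : cong n (b - 1) (N ^ k2 * (b - 1)).
    by apply: cong_sym; apply: cong_scale => //; apply: ZnB => //; exact: Zn1.
  by have := congD n_ge2 (cong_refl n 1) cb; rewrite subrKC.
exists f; split=> //.
- exists a => // t /andP[t0 ta]; rewrite !mul1r !add0r f1 ?t0 // f1 ?lexx ?(ltW a0) //.
  by rewrite mulr0 !addr0 add0r.
- exists (1 - b); first by rewrite subr_gt0.
  move=> t /andP[t0 tb]; rewrite !mulN1r !f2 ?lexx ?(ltW b1) //; first by ring.
  by rewrite gerBl t0 andbT; lra.
Qed.

End Germs.

(** * Compressing intervals *)

Section Compression.
Context {R : realType} (n : nat) (n_ge2 : (2 <= n)%N).
Local Notation N := (n%:R : R).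
Local Notation Zn := (@Zn R n).
Local Notation F := (@F R n).
Implicit Types (f g h : R -> R) (s : seq R).

Definition agree (a b : R) (f g : R -> R) : Prop := forall x, a <= x <= b -> f x = g x.

Definition piecewise_in (H : set (R -> R)) f : Prop :=
  exists s, (forall c, c \in s -> Zn c) /\
    forall a b, 0 <= a -> a < b -> b <= 1 -> unbroken s a b ->
      exists2 h, H h & agree a b f h.

Record group_in_F (H : set (R -> R)) : Prop := GroupInF {
  group_sub : H `<=` F;
  group_id : H idfun;
  group_comp : forall f g, H f -> H g -> H (g \o f);
  group_inv : forall f g, H f -> inverse f g -> H g
}.

Context (H : set (R -> R)) (grp : group_in_F H).

Lemma group_lt h : H h -> {mono h : x y / x < y}.
Proof. by move=> /(group_sub grp) /(F_PLn n_ge2) /(PLn_lt n_ge2). Qed.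

Lemma group_le h : H h -> {mono h : x y / x <= y}.
Proof. by move=> /(group_sub grp) /(F_PLn n_ge2) /(PLn_le n_ge2). Qed.

Lemma group_inverse h : H h -> exists2 g, H g & inverse h g.
Proof.
move=> Hh; have [[g hg] _ _] := F_PLn n_ge2 (group_sub grp Hh).
by exists g => //; exact: (group_inv grp Hh).
Qed.

Lemma group_0 h : H h -> h 0 = 0.
Proof. by move=> /(group_sub grp) /(F_id_outside n_ge2) ->; rewrite ?lexx. Qed.

Lemma group_1 h : H h -> h 1 = 1.
Proof. by move=> /(group_sub grp) /(F_id_outside n_ge2) ->; rewrite ?lexx ?orbT. Qed.

Lemma group_gt0 h x : H h -> (0 < h x) = (0 < x).
Proof. by move=> Hh; rewrite -{1}(group_0 Hh) group_lt. Qed.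

Lemma group_lt1 h x : H h -> (h x < 1) = (x < 1).
Proof. by move=> Hh; rewrite -{1}(group_1 Hh) group_lt. Qed.

Lemma free_right s (x y : R) : x < y -> exists b, x < b <= y /\ unbroken s x b.
Proof.
elim: s y => [|c s IH] y xy; first by exists y; rewrite xy lexx.
have [xc|cx] := ltP x c.
  have [|b [/andP[xb]]] := IH (Num.min y c); first by rewrite lt_min xy.
  rewrite le_min => /andP[b_y bc] fr; exists b; rewrite xb b_y; split=> // d.
  rewrite in_cons => /orP[/eqP -> /andP[_]|/fr //]; by rewrite ltNge bc.
have [b [xb fr]] := IH y xy; exists b; split=> // d.
by rewrite in_cons => /orP[/eqP -> /andP[]|/fr //]; rewrite ltNge cx.
Qed.

Context (pw : forall f, F f -> piecewise_in H f).

Lemma agree_right f x : F f -> 0 <= x < 1 ->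
  exists h b, [/\ H h, x < b <= 1 & agree x b f h].
Proof.
move=> /pw[s [_ sE]] /andP[x0 x1].
have [b [/andP[xb b1] fr]] := free_right s x1.
by have [h Hh fh] := sE x b x0 xb b1 fr; exists h, b; rewrite xb.
Qed.

Lemma same_orbits f x : F f -> 0 <= x < 1 -> exists2 h, H h & h x = f x.
Proof.
move=> Ff x01; have [h [b [Hh /andP[xb _] ->]]] := agree_right Ff x01.
  by exists h.
by rewrite lexx ltW.
Qed.

Lemma push_left (b q : R) : 0 < b < 1 -> 0 < q -> exists2 g, H g & g b < q.
Proof.
move=> /andP[b0 b1] q0.
have [||||||f [Ff _ fb]] := @F_compress R n n_ge2 (b / 2) b 0 (Num.min q 1).
- by rewrite divr_gt0.
- by rewrite ltr_pdivrMr // ltr_pMr // ltr1n.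
- by [].
- by [].
- by rewrite lt_min q0 /=.
- by rewrite ge_min lexx orbT.
have [|g Hg gE] := same_orbits Ff (x := b); first by rewrite ltW.
by exists g => //; rewrite gE (lt_le_trans fb) // ge_min lexx.
Qed.

Lemma push_right (a q : R) : 0 < a < 1 -> q < 1 -> exists2 g, H g & q < g a.
Proof.
move=> a01 q1; have /andP[a0 a1] := a01.
have [q0|q0] := leP q 0.
  by exists idfun; [exact: group_id|rewrite (le_lt_trans q0)].
have [|g Hg gq] := @push_left q a _ a0; first by rewrite q0.
have [h Hh [gK hK]] := group_inverse Hg; exists h => //.
by rewrite -(gK q) (group_lt Hh).
Qed.

Lemma piecewise_chain f (Q : R -> R -> Prop) (a b : R) : F f ->
  (forall x y h, a <= x -> x < y -> y <= b -> H h -> agree x y f h -> Q x y) ->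
  (forall x c y, a <= x -> x < c -> c < y -> y <= b -> Zn c ->
     Q x c -> Q c y -> Q x y) ->
  0 <= a -> a < b -> b <= 1 -> Q a b.
Proof.
move=> /pw[s [Zs sE]] base step a0 ab b1.
apply: (@interval_split_ind R s a b Q) => // [x y ax xy yb fr|x c y ax xc cy yb cs].
  have [||h Hh fh] := sE x y _ xy _ fr; first exact: le_trans ax.
    exact: le_trans b1.
  exact: (base x y h).
exact: step (Zs _ cs).
Qed.

Context (ends : forall f, F f -> exists2 h, H h &
  exists2 d, 0 < d & forall x, (x <= d) || (1 - d <= x) -> h x = f x).

Lemma end_slopes_in (k1 k2 : int) : (k1 = 0 \/ k1 = -1) -> (k2 = 0 \/ k2 = -1) ->
  exists h d c, [/\ H h, 0 < d & d <= c < 1] /\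
  [/\ forall x, 0 <= x <= d -> h x = N ^ k1 * x
    & forall x, c <= x <= 1 -> h x = 1 - N ^ k2 * (1 - x)].
Proof.
move=> k1E k2E; have [f [Ff [e e0 f0] [e' e'0 f1]]] := @F_end_slopes R n n_ge2 k1 k2 k1E k2E.
have [h Hh [d d0 hE]] := ends Ff.
have F0 : f 0 = 0 by rewrite (F_id_outside n_ge2 Ff) ?lexx.
have F1 : f 1 = 1 by rewrite (F_id_outside n_ge2 Ff) ?lexx ?orbT.
set t := Num.min (Num.min e e') (Num.min d (1 / 2)).
have t0 : 0 < t by rewrite !lt_min e0 e'0 d0 divr_gt0.
have : t <= t by [].
rewrite {2}/t !le_min => /and3P[/andP[te te'] td t2].
exists h, t, (1 - t); split; [split=> //; lra|split=> x /andP[x1 x2]].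
- rewrite hE ?(le_trans x2 td) //.
  by have := f0 x; rewrite F0 !mul1r !add0r x1 => ->; rewrite // (le_trans x2).
- rewrite hE; last by apply/orP; right; lra.
  have := f1 (1 - x); rewrite F1 !mulN1r.
  have -> : 1 + - (1 - x) = x by ring.
  by apply; lra.
Qed.

Lemma shrink_near_0 : exists k d c, [/\ H k, 0 < d < 1 & d <= c < 1] /\
  [/\ forall x, 0 <= x <= d -> k x = N^-1 * x & forall x, c <= x -> k x = x].
Proof.
have [||h [d [c [[Hh d0 dc] [h0 h1]]]]] := @end_slopes_in (-1) 0; try by [left|right].
have /andP[dc' c1] := dc.
exists h, d, c; split; [by split=> //; rewrite d0 (le_lt_trans dc')|split=> x].
  by rewrite -exprN1; exact: h0.
move=> cx; have [x1|x1] := leP 1 x.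
  by rewrite (F_id_outside n_ge2 (group_sub grp Hh)) // x1 orbT.
by rewrite h1 ?cx ?(ltW x1) // expr0z mul1r opprB addrC subrK.
Qed.

Context (l e : R) (le01 : [/\ 0 < l, l < e & e < 1])
  (base : forall p q : R, 0 <= p -> p < q -> q <= 1 ->
     exists2 g, H g & p < g l /\ g e < q).

(** Compressible into [l, e], which by [base] can itself be moved into any open
    interval. *)
Definition shrinkable (x y : R) : Prop := exists2 g, H g & l <= g x /\ g y <= e.

Fixpoint chain (k : nat) (x y : R) : Prop :=
  if k is k'.+1 then exists2 z, shrinkable x z & chain k' z y else y <= x.

Lemma shrinkable_sub x y x' y' : x <= x' -> y' <= y -> shrinkable x y -> shrinkable x' y'.
Proof.
move=> xx yy [g Hg [gx gy]]; exists g => //.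
by rewrite (le_trans gx) ?(le_trans _ gy) // (group_le Hg).
Qed.

Lemma shrinkable_image h x y : H h -> shrinkable (h x) (h y) -> shrinkable x y.
Proof.
by move=> Hh [g Hg gxy]; exists (g \o h) => //; exact: (group_comp grp).
Qed.

Lemma chain_sub k x y x' y' : x <= x' -> y' <= y -> chain k x y -> chain k x' y'.
Proof.
elim: k x x' => [|k IH] x x' xx yy /=.
  by move=> yx; rewrite (le_trans yy) // (le_trans yx).
move=> [z xz zy]; exists z; first exact: shrinkable_sub xz.
exact: IH zy.
Qed.

Lemma chain_image k h x y : H h -> chain k (h x) (h y) -> chain k x y.
Proof.
move=> Hh; have [h' Hh' [hK h'K]] := group_inverse Hh.
elim: k x => [|k IH] x /=; first by rewrite (group_le Hh).
move=> [z xz zy]; exists (h' z); first by apply: (shrinkable_image Hh); rewrite h'K.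
by apply: IH; rewrite h'K.
Qed.

Lemma chain_cat j k x y z : chain j x y -> chain k y z -> chain (j + k) x z.
Proof.
elim: j x => [|j IH] x /=; first by move=> yx; exact: chain_sub.
by move=> [t xt ty] yz; exists t => //; exact: IH.
Qed.

(** Some element of [F n] compresses [a, b] into [l, e]; the links of the chain are
    the pieces on which it agrees with elements of [H]. *)
Lemma chain_exists (a b : R) : 0 < a -> a < b -> b < 1 -> exists k, chain k a b.
Proof.
move=> a0 ab b1; have [l0 le e1] := le01.
have [f [Ff fa fb]] := F_compress n_ge2 a0 ab b1 (ltW l0) le (ltW e1).
have f_le := PLn_le n_ge2 (F_PLn n_ge2 Ff).
apply: (piecewise_chain (Q := fun a b => exists k, chain k a b) Ff) => //.
- move=> x y h ax xy yb Hh fh; exists 1%N, y => //=; exists h => //.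
  rewrite -!fh ?lexx ?(ltW xy) //; split.
    by rewrite (le_trans (ltW fa)) // f_le.
  by rewrite (le_trans _ (ltW fb)) // f_le.
- by move=> x c y _ _ _ _ _ [j xc] [k cy]; exists (j + k)%N; exact: chain_cat xc cy.
- exact: ltW.
- exact: ltW.
Qed.

(** Pulling the left end of a chain towards 0 by an element which fixes the
    right end does not change its length, and any interval can be pushed
    below that right end: the number of links can be chosen once for all. *)
Lemma chain_uniform : exists k, forall a b : R, 0 < a -> a < b -> b < 1 -> chain k a b.
Proof.
have [h [d [c [[Hh /andP[d0 d1] /andP[dc c1]] [hd hc]]]]] := shrink_near_0.
have c0 : 0 < c := lt_le_trans d0 dc.
have [k dk] : exists k, chain k d c.
  move: dc; rewrite le_eqVlt => /orP[/eqP <-|dc]; first by exists 0%N => /=.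
  exact: chain_exists.
have dj j : chain k (N ^- j * d) c.
  elim: j => [|j IH]; first by rewrite expr0 invr1 mul1r.
  have [h' Hh' [hK h'K]] := group_inverse Hh.
  have h'c : h' c = c by rewrite -{1}(hc c) // hK.
  apply: (chain_image Hh'); rewrite h'c.
  suff -> : N ^- j.+1 * d = h (N ^- j * d) by rewrite hK.
  rewrite hd; first by rewrite exprS invfM mulrA.
  rewrite mulr_ge0 ?invr_ge0 ?exprn_ge0 ?(ltW d0) //=.
  rewrite ler_piMl ?(ltW d0) // invf_le1 ?exprn_gt0 ?base_gt0 //.
  by rewrite exprn_ege1 // ltW // base_gt1.
exists k => a b a0 ab b1.
have b01 : 0 < b < 1 by rewrite b1 (lt_trans a0).
have [g Hg gb] := push_left b01 c0.
apply: (chain_image Hg).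
have ga0 : 0 < g a by rewrite group_gt0.
have [|j jd] := @small_expn R n n_ge2 (g a / d); first by rewrite divr_gt0.
apply: chain_sub (dj j); last exact: ltW.
by rewrite ltW // -ltr_pdivlMr.
Qed.

(** Intervals that are not shrinkable, [k] of them placed side by side, defeat
    every chain of length [k]. *)
Lemma not_chain :
  (forall x : R, 0 < x -> x < 1 -> exists y, [/\ x < y, y < 1 & ~ shrinkable x y]) ->
  forall k (x : R), 0 < x -> x < 1 -> exists y, [/\ x < y, y < 1 & ~ chain k x y].
Proof.
move=> ns; elim=> [|k IH] x x0 x1.
  have [y [xy y1 _]] := ns x x0 x1; exists y; split=> //=.
  by rewrite leNgt xy.
have [y [xy y1 nxy]] := ns x x0 x1; have [z [yz z1 nyz]] := IH y (lt_trans x0 xy) y1.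
exists z; split=> //=; first exact: lt_trans yz.
move=> [t xt tz]; apply: nyz; apply: chain_sub tz => //.
rewrite leNgt; apply/negP => yt; apply: nxy.
by apply: shrinkable_sub xt; rewrite ?lexx // ltW.
Qed.

(** The translates of one interval that is not shrinkable would give such an
    interval to the right of every point, against [chain_uniform]. *)
Lemma all_shrinkable (a b : R) : 0 < a -> a < b -> b < 1 -> shrinkable a b.
Proof.
move=> a0 ab b1; apply: contrapT => nab.
have [k ck] := chain_uniform.
have [|||y [xy y1 []]] := not_chain _ k (x := a); [|by []|exact: lt_trans b1|].
- move=> x x0 x1.
  have a01 : 0 < a < 1 by rewrite a0 (lt_trans ab).
  have [g Hg xg] := push_right a01 x1; exists (g b); split.
  + by rewrite (lt_trans xg) // group_lt.
  + by rewrite group_lt1.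
  + move=> xgb; apply: nab; apply: (shrinkable_image Hg).
    by apply: shrinkable_sub xgb; rewrite ?lexx // ltW.
- exact: ck.
Qed.

Lemma compress (a b p q : R) : 0 < a -> a < b -> b < 1 -> 0 <= p -> p < q -> q <= 1 ->
  exists2 g, H g & p < g a /\ g b < q.
Proof.
move=> a0 ab b1 p0 pq q1.
have [g Hg [ga gb]] := all_shrinkable a0 ab b1.
have [h Hh [hl he]] := base p0 pq q1.
exists (h \o g); first exact: (group_comp grp).
by rewrite /= (lt_le_trans hl) ?(le_lt_trans _ he) // (group_le Hh).
Qed.

End Compression.

(** * Gluing two elements of a subgroup at a breakpoint *)

(** The supremum of the orbit of [x] is fixed by [K], so it is [q]. *)
Lemma orbit_cofinal (R : realType) (K : set (R -> R)) (p q : R) :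
  K idfun -> (forall k, K k -> {mono k : x y / x < y}) ->
  (forall f g, K f -> K g -> K (g \o f)) ->
  (forall k, K k -> exists2 k', K k' & inverse k k') ->
  (forall k, K k -> k q = q) ->
  (forall y, p < y < q -> exists2 k, K k & k y <> y) ->
  forall x z, p < x < q -> z < q -> exists2 k, K k & z < k x.
Proof.
move=> K1 Kmono Kcomp Kinv Kq Kmove x z /andP[px xq] zq.
pose S := [set k x | k in K].
have Sq : ubound S q.
  by move=> _ [k Kk <-]; rewrite -(Kq _ Kk) ltW // Kmono.
have supS : has_sup S by split; [exists x, idfun|exists q].
have xS : S x by exists idfun.
suff sq : sup S = q.
  have [_ [k Kk <-]] : exists2 y, S y & z < y by apply: sup_gt; [exists x|rewrite sq].
  by exists k.
apply/eqP; rewrite eq_le ge_sup //=; last by exists x.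
rewrite leNgt; apply/negP => sq.
have ps : p < sup S by apply: lt_le_trans px _; exact: sup_upper_bound.
have [k Kk ks] : exists2 k, K k & sup S < k (sup S).
  have [|k Kk] := Kmove (sup S); first by rewrite ps.
  move=> /eqP; rewrite neq_lt => /orP[ks|ks]; last by exists k.
  have [k' Kk' [kK k'K]] := Kinv k Kk; exists k' => //.
  by rewrite -(Kmono k) // k'K.
have [k' Kk' [kK k'K]] := Kinv k Kk.
have [_ [k1 Kk1 <-] h1] : exists2 y, S y & k' (sup S) < y.
  by apply: sup_gt; [exists x|rewrite -(Kmono k) // k'K].
have : k (k1 x) <= sup S.
  by apply: sup_upper_bound => //; exists (k \o k1) => //; exact: Kcomp.
by rewrite leNgt -{1}(k'K (sup S)) Kmono // h1.
Qed.

Section Patching.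
Context {R : realType} (n : nat) (n_ge2 : (2 <= n)%N).
Local Notation N := (n%:R : R).
Local Notation Zn := (@Zn R n).
Local Notation F := (@F R n).
Implicit Types (f g h : R -> R) (s : seq R).

Context (H : set (R -> R)) (grp : group_in_F n H).
Context (ends : forall f, F f -> exists2 h, H h &
  exists2 d, 0 < d & forall x, (x <= d) || (1 - d <= x) -> h x = f x).
Context (compress : forall a b p q : R, 0 < a -> a < b -> b < 1 ->
  0 <= p -> p < q -> q <= 1 -> exists2 g, H g & p < g a /\ g b < q).

Let H_lt := group_lt n_ge2 grp.
Let H_le := group_le n_ge2 grp.

Lemma inverse_fix f g (x : R) : inverse f g -> f x = x -> g x = x.
Proof. by move=> [fK _] fx; rewrite -{1}fx fK. Qed.

(** The element of [shrink_near_0] moves all points near 0 and fixes all points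
    near 1; a conjugator that compresses the region in between into the interval
    from [y] to [al] turns it into an element moving [y] and supported left of
    [al]. *)
Lemma move_left_of (y al : R) : 0 < y -> y < al -> al < 1 ->
  exists2 k, H k /\ (forall x, al <= x -> k x = x) & k y <> y.
Proof.
move=> y0 yal al1.
have [k [d [c [[Hk /andP[d0 d1] /andP[dc c1]] [kd kc]]]]] := shrink_near_0 n_ge2 grp ends.
have d2 : d / 2 < d by rewrite ltr_pdivrMr // ltr_pMr // ltr1n.
have [||||||g Hg [yg gc]] := @compress (d / 2) c y al; rewrite ?(ltW y0) ?(ltW al1) //.
- by rewrite divr_gt0.
- exact: lt_le_trans dc.
have [g' Hg' gg'] := group_inverse n_ge2 grp Hg; have [gK g'K] := gg'.
exists (g \o (k \o g')); first split.
- by apply: (group_comp grp) => //; exact: (group_comp grp).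
- move=> x alx /=; rewrite kc ?g'K //.
  by rewrite -(H_le Hg) g'K (le_trans (ltW gc)).
- have g'y0 : 0 < g' y by rewrite (group_gt0 n_ge2 grp).
  move=> /= /(congr1 g'); rewrite gK kd; last first.
    by rewrite ltW //= -(H_le Hg) g'K ltW // (lt_trans yg) // H_lt.
  move=> /eqP; rewrite -subr_eq0 -{2}[g' y]mul1r -mulrBl mulf_eq0 (gt_eqF g'y0) orbF.
  by rewrite subr_eq0 invr_eq1 gt_eqF // base_gt1.
Qed.

Lemma shrink_near_1 : exists k c d, [/\ H k, 0 < c & c <= d < 1] /\
  [/\ forall x, x <= c -> k x = x & forall x, d <= x < 1 -> k x <> x].
Proof.
have [||h [c [d [[Hh c0 cd] [h0 h1]]]]] := @end_slopes_in R n n_ge2 H ends 0 (-1);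
  try by [left|right].
exists h, c, d; split=> //; split=> x.
  move=> xc; have [x0|x0] := leP x 0.
    by rewrite (F_id_outside n_ge2 (group_sub grp Hh)) // x0.
  by rewrite h0 ?xc ?(ltW x0) // expr0z mul1r.
move=> /andP[dx x1]; rewrite h1 ?dx ?(ltW x1) // exprN1 => hx.
have : N^-1 * (1 - x) = 1 - x by lra.
move=> /eqP; rewrite -subr_eq0 -{2}[1 - x]mul1r -mulrBl mulf_eq0.
by rewrite !subr_eq0 invr_eq1 gt_eqF ?base_gt1 // gt_eqF.
Qed.

Lemma move_right_of (y al : R) : 0 < al -> al < y -> y < 1 ->
  exists2 k, H k /\ (forall x, x <= al -> k x = x) & k y <> y.
Proof.
move=> al0 aly y1.
have [k [c [d [[Hk c0 /andP[cd d1]] [kc kd]]]]] := shrink_near_1.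
have [t dt t1] : exists2 t, d < t & t < 1.
  by exists ((d + 1) / 2); [rewrite midf_lt|rewrite midf_lt].
have [||||||g Hg [alg gy]] := @compress c t al y; rewrite ?(ltW al0) ?(ltW y1) //.
- exact: le_lt_trans dt.
have [g' Hg' gg'] := group_inverse n_ge2 grp Hg; have [gK g'K] := gg'.
exists (g \o (k \o g')); first split.
- by apply: (group_comp grp) => //; exact: (group_comp grp).
- move=> x xal /=; rewrite kc ?g'K //.
  by rewrite -(H_le Hg) g'K (le_trans xal) // ltW.
- move=> /= /(congr1 g'); rewrite gK; apply: kd.
  rewrite (group_lt1 n_ge2 grp) // y1 andbT -(H_le Hg) g'K ltW // (lt_trans _ gy) //.
  by rewrite H_lt.
Qed.

(** By [move_left_of] the elements supported left of [al] have no common fixed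
    point between 0 and [al]. *)
Lemma push_towards_left (a z al : R) : 0 < a < al -> al < 1 -> z < al ->
  exists2 k, H k /\ (forall x, al <= x -> k x = x) & z < k a.
Proof.
move=> aal al1 zal.
apply: (@orbit_cofinal R [set k | H k /\ (forall x, al <= x -> k x = x)] 0 al) => //.
- by split=> //; exact: (group_id grp).
- by move=> k [Hk _]; exact: H_lt.
- move=> f g [Hf fE] [Hg gE]; split; first exact: (group_comp grp).
  by move=> x alx /=; rewrite fE // gE.
- move=> k [Hk kE]; have [k' Hk' kk'] := group_inverse n_ge2 grp Hk.
  by exists k' => //; split=> // x /kE; exact: inverse_fix.
- by move=> k [_ ->].
- by move=> y /andP[y0 yal]; exact: move_left_of.
Qed.

Lemma push_towards_right (b z al : R) : al < b < 1 -> 0 < al -> al < z < 1 ->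
  exists2 k, H k /\ (forall x, x <= al -> k x = x) & k b < z.
Proof.
move=> /andP[alb b1] al0 alz.
have [||||||k [Hk kE] bk] := @orbit_cofinal R
    [set k | H k /\ (forall x, x <= al -> k x = x)] al 1 _ _ _ _ _ _ z b alz b1.
- by split=> //; exact: (group_id grp).
- by move=> k [Hk _]; exact: H_lt.
- move=> f g [Hf fE] [Hg gE]; split; first exact: (group_comp grp).
  by move=> x alx /=; rewrite fE // gE.
- move=> k [Hk kE]; have [k' Hk' kk'] := group_inverse n_ge2 grp Hk.
  by exists k' => //; split=> // x /kE; exact: inverse_fix.
- by move=> k [Hk _]; exact: (group_1 n_ge2 grp).
- by move=> y /andP[aly y1]; exact: move_right_of.
have [k' Hk' kk'] := group_inverse n_ge2 grp Hk; exists k'.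
  by split=> // x /kE; exact: inverse_fix.
by rewrite -(H_lt Hk) (proj2 kk').
Qed.

Context (bump : forall al : R, Zn al -> 0 < al < 1 -> exists h,
  [/\ H h, h al = al, germ n (-1) h al 0 & germ n 1 h al 1]).

Lemma bump_pow (al : R) (s : int) : Zn al -> 0 < al < 1 -> exists h,
  [/\ H h, h al = al, germ n (-1) h al 0 & germ n 1 h al s].
Proof.
move=> Zal al01.
have nat_case (m : nat) : exists h,
    [/\ H h, h al = al, germ n (-1) h al 0 & germ n 1 h al m].
  elim: m => [|m [h [Hh hal hl hr]]].
    by exists idfun; split=> //; [exact: (group_id grp)|exact: germ_id|exact: germ_id].
  have [g [Hg gal gl gr]] := bump Zal al01; exists (g \o h).
  split; [exact: (group_comp grp)|by rewrite /= hal| |].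
    by apply: (@germ_comp R n n_ge2 _ h g al 0 0) => //; rewrite hal.
  by rewrite -addn1 PoszD; apply: (germ_comp n_ge2 hr); rewrite hal.
case: s => m; first exact: nat_case.
have [h [Hh hal hl hr]] := nat_case m.+1.
have [g Hg hg] := group_inverse n_ge2 grp Hh; exists g; split=> //.
- exact: inverse_fix hal.
- by have := germ_inv n_ge2 hl hg; rewrite hal.
- by have := germ_inv n_ge2 hr hg; rewrite hal NegzE.
Qed.

Lemma germ0_left h (p : R) : h p = p -> germ n (-1) h p 0 ->
  exists2 e, 0 < e & forall x, p - e <= x <= p -> h x = x.
Proof.
move=> hp [e e0 hE]; exists e => // x /andP[x1 x2].
have := hE (p - x); rewrite hp expr0z mul1r !mulN1r.
have -> : p + - (p - x) = x by ring.
by apply; lra.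
Qed.

Lemma germ0_right h (p : R) : h p = p -> germ n 1 h p 0 ->
  exists2 e, 0 < e & forall x, p <= x <= p + e -> h x = x.
Proof.
move=> hp [e e0 hE]; exists e => // x /andP[x1 x2].
have := hE (x - p); rewrite hp expr0z !mul1r.
have -> : p + (x - p) = x by ring.
by apply; lra.
Qed.

(** Dividing by [h2], it suffices to make [h1] trivial on [al, b] without changing
    it on [a, al]. Its slope on the right of [al] is cancelled by an element that
    is trivial on [a, al]. What remains is trivial just to the right of [al], and
    conjugation by an element that is trivial on the left of [al] spreads this
    short interval over [al, b]. *)
Lemma patch (a al b : R) h1 h2 : Zn al -> 0 < a -> a < al -> al < b -> b < 1 ->
  H h1 -> H h2 -> h1 al = h2 al ->
  exists h, [/\ H h, agree a al h h1 & agree al b h h2].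
Proof.
move=> Zal a0 aal alb b1 Hh1 Hh2 h12.
have al01 : 0 < al < 1 by rewrite (lt_trans a0) // (lt_trans alb).
have /andP[al0 al1] := al01.
have [h2' Hh2' [h2K h2'K]] := group_inverse n_ge2 grp Hh2.
have Hg : H (h2' \o h1) by exact: (group_comp grp).
set g := h2' \o h1 in Hg *.
have gal : g al = al by rewrite /g /= h12 h2K.
have [s gs] := germ_exists al (mul1r 1) (F_PLn n_ge2 (group_sub grp Hg)).
have [e [He eal el er]] := bump_pow s Zal al01.
have [t t0 et] := germ0_left eal el.
(* [e'] has the right slope of [g] and is the identity on the whole of [a, al]. *)
have [e' [He' e'l e'al e'r]] : exists e', [/\ H e', forall x, a <= x <= al -> e' x = x,
    e' al = al & germ n 1 e' al s].
  have [||c [Hc cE] ca] := @push_towards_left a (al - t) al _ al1; first by rewrite a0.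
    by rewrite ltrBlDr ltrDl.
  have [c' Hc' cc'] := group_inverse n_ge2 grp Hc.
  have cal := cE al (lexx _).
  have right_e x : al <= x -> c' (e (c x)) = e x.
    move=> alx; rewrite cE // (inverse_fix cc') // cE //.
    by rewrite -eal H_le.
  exists (c' \o (e \o c)); split=> /=.
  - by apply: (group_comp grp) => //; exact: (group_comp grp).
  - move=> x /andP[ax xal]; rewrite et ?(proj1 cc') //.
    by rewrite (le_trans (ltW ca)) ?H_le //= -cal H_le.
  - by rewrite right_e // eal.
  - have [d d0 dE] := er; exists d => // x /andP[x0 xd] /=.
    by rewrite !right_e ?dE ?x0 // mul1r lerDl.
have [e'' He'' ee] := group_inverse n_ge2 grp He'.
have Hr1 : H (g \o e'') by exact: (group_comp grp).
have e''al : e'' al = al by exact: inverse_fix ee _.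
have r1l x : a <= x <= al -> (g \o e'') x = g x.
  by move=> xal; rewrite /= (inverse_fix ee) // e'l.
have r1r : germ n 1 (g \o e'') al 0.
  rewrite [X in germ _ _ _ _ X](_ : _ = - s + s); last by rewrite addNr.
  apply: germ_comp; rewrite // ?e''al //.
  by have := germ_inv n_ge2 e'r ee; rewrite e'al.
have r1al : (g \o e'') al = al by rewrite /= e''al.
set r1 := g \o e'' in Hr1 r1l r1r r1al.
have [t' t'0 r1t] := germ0_right r1al r1r.
have [||c [Hc cE] cb] := @push_towards_right b (Num.min b (al + t')) al _ al0.
- by rewrite alb.
- by rewrite lt_min alb ltrDl t'0 gt_min b1.
have [c' Hc' cc'] := group_inverse n_ge2 grp Hc.
exists (h2 \o (c' \o (r1 \o c))); split.
- apply: (group_comp grp) => //; apply: (group_comp grp) => //.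
  exact: (group_comp grp).
- move=> x /andP[ax xal] /=; rewrite cE // r1l ?ax // (inverse_fix cc').
    by rewrite /g /= h2'K.
  by apply: cE; rewrite -gal H_le.
- move=> x /andP[alx xb] /=; rewrite r1t ?(proj1 cc') //.
  rewrite -{1}(cE al) // H_le // alx /= (le_trans _ (ltW (lt_le_trans cb _))) ?H_le //.
  by rewrite ge_min lexx orbT.
Qed.

Context (pw : forall f, F f -> piecewise_in n H f).

Lemma locally_all f (a b : R) : F f -> 0 < a -> a < b -> b < 1 ->
  exists2 h, H h & agree a b f h.
Proof.
move=> Ff a0 ab b1.
apply: (piecewise_chain pw (Q := fun x y => exists2 h, H h & agree x y f h) Ff) => //.
- by move=> x y h _ _ _ Hh fh; exists h.
- move=> x c y ax xc cy yb Zc [h1 Hh1 f1] [h2 Hh2 f2].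
  have [|||||||h [Hh e1 e2]] := @patch x c y h1 h2 Zc; rewrite //.
  + exact: lt_le_trans ax.
  + exact: le_lt_trans b1.
  + by rewrite -f1 ?lexx ?(ltW xc) // -f2 ?lexx ?(ltW cy).
  exists h => // z /andP[xz zy]; have [zc|cz] := leP z c.
    by rewrite f1 ?xz // e1 ?xz.
  by rewrite f2 ?(ltW cz) // e2 ?(ltW cz).
- exact: ltW.
- exact: ltW.
Qed.

End Patching.

(** * From local to global: commutators *)

Section Commutators.
Context {R : realType} (n : nat) (n_ge2 : (2 <= n)%N).
Local Notation N := (n%:R : R).
Local Notation Zn := (@Zn R n).
Local Notation F := (@F R n).
Implicit Types (f g h x y : R -> R) (s : seq R).

Context (H : set (R -> R)) (grp : group_in_F n H).
Context (push : forall b q : R, 0 < b < 1 -> 0 < q -> exists2 g, H g & g b < q).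
Context (local : forall f (a b : R), F f -> 0 < a -> a < b -> b < 1 ->
  exists2 h, H h & agree a b f h).

Let H_lt := group_lt n_ge2 grp.
Let H_le := group_le n_ge2 grp.

Lemma id_outside_itv (p q : R) f : {mono f : t z / t <= z} -> id_outside p q f ->
  forall t, (p <= f t <= q) = (p <= t <= q).
Proof.
move=> fle fid t; have fp : f p = p by rewrite fid ?lexx.
have fq : f q = q by rewrite fid ?lexx ?orbT.
by rewrite -{1}fp -{1}fq !fle.
Qed.

(** The commutator of [h] and [c] equals [x] on [p, q] when [h] extends [x] far
    enough to the left and [c] moves [p, q] to where [x] is trivial; being a
    commutator, it is trivial near the end points. *)
Lemma extend_trivially x (p q : R) : F x -> id_outside p q x -> 0 < p -> p < q -> q < 1 ->
  exists h, [/\ H h, fix_near_ends h & agree p q x h].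
Proof.
move=> Fx xid p0 pq q1.
have q01 : 0 < q < 1 by rewrite q1 (lt_trans p0).
have [c Hc cq] := push q01 p0; have [c' Hc' cc'] := group_inverse n_ge2 grp Hc.
have cp0 : 0 < c p by rewrite (group_gt0 n_ge2 grp).
have cpq : c p < q by rewrite (lt_trans _ (lt_trans cq pq)) // H_lt.
have [h Hh xh] := local Fx cp0 cpq q1.
have [h' Hh' hh'] := group_inverse n_ge2 grp Hh.
exists (h \o (c' \o (h' \o c))); split.
- apply: (group_comp grp) => //; apply: (group_comp grp) => //.
  exact: (group_comp grp).
- apply: (commutator_fix_near_ends n_ge2) => //; try exact: (group_sub grp).
  exact: inverse_sym.
- move=> t /andP[pt tq] /=.
  have ct : h (c t) = c t.
    rewrite -xh ?H_le ?pt ?(le_trans _ (ltW (lt_trans cq pq))) ?H_le //.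
    by apply: xid; rewrite (le_trans _ (ltW cq)) // H_le.
  rewrite (inverse_fix hh' ct) (proj1 cc') xh // tq andbT (le_trans _ pt) // ltW //.
  by rewrite (lt_trans _ cq) // H_lt.
Qed.

(** Take [h] from [extend_trivially] for [x], and [k] equal to [y] except near the
    end points, where [h] is trivial. As [k] is also trivial wherever [h] fails to
    realize [x], the commutator of [h] and [k] is exactly that of [x] and [y]. *)
Lemma commutator_in x y x' y' (p q : R) : F x -> F y -> inverse x x' -> inverse y y' ->
  id_outside p q x -> id_outside p q y -> 0 < p -> p < q -> q < 1 ->
  H (y \o (x \o (y' \o x'))).
Proof.
move=> Fx Fy xx' yy' xid yid p0 pq q1.
have [h [Hh [d d0 hd] xh]] := extend_trivially Fx xid p0 pq q1.
pose d1 := Num.min d (Num.min p (1 - q)).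
have d10 : 0 < d1 by rewrite !lt_min d0 p0 subr_gt0.
have d1d : d1 <= d by rewrite ge_min lexx.
have d1p : d1 <= p by rewrite !ge_min lexx orbT.
have d1q : q <= 1 - d1.
  have : d1 <= 1 - q by rewrite !ge_min lexx !orbT.
  by lra.
have d11 : d1 < 1 - d1 by rewrite (le_lt_trans d1p) // (lt_le_trans pq).
have {}hd t : (t <= d1) || (1 - d1 <= t) -> h t = t.
  move=> td; apply: hd; case/orP: td => td; apply/orP; [left|right].
    exact: le_trans d1d.
  by apply: le_trans td; rewrite lerD2l lerN2.
have [|k Hk yk] := local Fy d10 d11; first by lra.
have [h' Hh' hh'] := group_inverse n_ge2 grp Hh.
have [k' Hk' kk'] := group_inverse n_ge2 grp Hk.
have x_le := PLn_le n_ge2 (F_PLn n_ge2 Fx); have y_le := PLn_le n_ge2 (F_PLn n_ge2 Fy).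
have [[xK x'K] [yK y'K]] := (xx', yy'); have [[hK h'K] [kK k'K]] := (hh', kk').
have kd (t : R) : (t = d1) \/ (t = 1 - d1) -> k t = t.
  move=> td; rewrite -yk.
    by apply: yid; case: td => ->; rewrite ?d1p ?d1q ?orbT.
  by case: td => ->; rewrite lexx (ltW d11).
suff -> : y \o (x \o (y' \o x')) = k \o (h \o (k' \o h')).
  apply: (group_comp grp) => //; apply: (group_comp grp) => //.
  exact: (group_comp grp).
apply/funext => w /=.
have x'itv t : (p <= x' t <= q) = (p <= t <= q).
  by rewrite -(id_outside_itv x_le xid) x'K.
have y'itv t : (p <= y' t <= q) = (p <= t <= q).
  by rewrite -(id_outside_itv y_le yid) y'K.
have yk' t : p <= t <= q -> y t = k t.
  by move=> /andP[pt tq]; apply: yk; rewrite (le_trans d1p) ?(le_trans tq).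
have [w_in|w_out] := boolP (p <= w <= q).
  have -> : h' w = x' w by rewrite -{1}(x'K w) xh ?hK // x'itv.
  have -> : k' (x' w) = y' (x' w).
    by rewrite -{1}(y'K (x' w)) yk' ?kK // y'itv x'itv.
  have x_in : p <= y' (x' w) <= q by rewrite y'itv x'itv.
  rewrite -(xh _ x_in) yk' //; by rewrite (id_outside_itv x_le xid).
have out t : ~~ (p <= t <= q) -> (t <= p) || (q <= t).
  by rewrite negb_and -!ltNge => /orP[] /ltW ->; rewrite ?orbT.
have x'w : x' w = w by apply: inverse_fix xx' _; rewrite xid // out.
have y'w : y' w = w by apply: inverse_fix yy' _; rewrite yid // out.
rewrite x'w y'w (xid _ (out _ w_out)) (yid _ (out _ w_out)).
have h'out : ~~ (p <= h' w <= q).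
  apply: contra w_out => h'w; have := xh _ h'w.
  by rewrite h'K => <-; rewrite (id_outside_itv x_le xid).
have h_d1 : h d1 = d1 by rewrite hd ?lexx.
have h_1d1 : h (1 - d1) = 1 - d1 by rewrite hd ?lexx ?orbT.
have [h'in|h'end] := boolP (d1 <= h' w <= 1 - d1).
  have -> : k' (h' w) = h' w.
    by apply: inverse_fix kk' _; rewrite -yk // yid // out.
  rewrite h'K -yk; first by rewrite yid // out.
  by rewrite -{1}h_d1 -{1}h_1d1 -(h'K w) !H_le.
have h'w : h' w = w.
  rewrite -{2}(h'K w) hd //; move: h'end; rewrite negb_and -!ltNge.
  by case/orP => /ltW ->; rewrite ?orbT.
rewrite h'w in h'end *.
rewrite hd ?k'K //; move: h'end; rewrite negb_and -!ltNge => /orP[wd|wd].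
  by rewrite -[_ <= d1](H_le Hk) k'K kd ?(ltW wd) //; left.
by rewrite -[1 - d1 <= _](H_le Hk) k'K kd ?(ltW wd) ?orbT //; right.
Qed.

(** Conjugation by [squeeze L] carries [F n] into the maps supported in a fixed
    compact part of the open unit interval, and does not change the maps that are
    supported in [L, 1 - L]. *)
Definition squeeze (L : R) : R -> R :=
  glue_at L (fun t => N ^ (-1) * t + (L - N ^ (-1) * L))
    (glue_at (1 - L) idfun (fun t => N ^ (-1) * t + (1 - L - N ^ (-1) * (1 - L)))).

(** An element of the derived subgroup is trivial near 0 and 1, so a suitable
    conjugation does not change it but replaces the commutators of which it is a
    product by commutators of compactly supported elements. *)
Lemma derived_in f : derived F f -> H f.
Proof.
move=> dFf; have [Ff [e e0 fe]] := derived_F_fix n_ge2 dFf.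
have [m me] : exists m : nat, N ^- m < Num.min e (1 / 2).
  by apply: small_expn => //; rewrite lt_min e0 /=; lra.
set L := N ^- m in me.
have L0 : 0 < L by rewrite invr_gt0 exprn_gt0 // base_gt0.
have [Le L2] : L < e /\ L < 1 / 2 by move: me; rewrite lt_min => /andP[].
have ZL : Zn L by rewrite /L exprnN; exact: Zn_expz.
have Zn1L : Zn (1 - L) by apply: ZnB => //; exact: Zn1.
have N1 : 0 < N^-1 < 1 by rewrite invr_gt0 base_gt0 // invf_lt1 ?base_gt0 // base_gt1.
have /andP[N1_gt0 N1_lt1] := N1.
have LL : L < 1 - L by lra.
set th := squeeze L.
have E1 : L = glue_at (1 - L) idfun (fun t => N ^ (-1) * t + (1 - L - N ^ (-1) * (1 - L))) L.
  by rewrite glue_at_left // ltW.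
have pth : PLn n th.
  have Zaff (c : R) : Zn c -> Zn (c - N ^ (-1) * c).
    by move=> Zc; apply: ZnB => //; apply: ZnM => //; exact: Zn_expz.
  apply: PLn_glue => //.
  - by rewrite -E1 addrC subrK.
  - by apply: PLn_affine => //; exact: Zaff.
  - apply: PLn_glue => //; first by rewrite [RHS]addrC subrK.
      exact: PLn_id.
    by apply: PLn_affine => //; exact: Zaff.
have [[th' thK] _ _] := pth; have [thK1 thK2] := thK.
have pth' := PLn_inv n_ge2 pth thK.
have th_mid t : L <= t <= 1 - L -> th t = t.
  move=> /andP[Lt tL]; rewrite /th /squeeze glue_at_right ?glue_at_left //.
    by rewrite addrC subrK.
  exact: ltW.
have th0 : th 0 = L - N^-1 * L.
  by rewrite /th /squeeze glue_at_left ?(ltW L0) // mulr0 add0r exprN1.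
have th1 : th 1 = 1 - L + N^-1 * L.
  have E2 (t : R) : t = N ^ (-1) * t + (t - N ^ (-1) * t) by rewrite addrC subrK.
  rewrite /th /squeeze glue_at_right; [|by rewrite -E1 -E2|by lra].
  rewrite glue_at_right; [|by rewrite -E2|by lra].
  by rewrite exprN1; ring.
have p_gt0 : 0 < th 0 by rewrite th0 -{1}[L]mul1r -mulrBl mulr_gt0 // subr_gt0.
have q_lt1 : th 1 < 1.
  have : 0 < L - N^-1 * L by rewrite -th0.
  by rewrite th1; lra.
have pq : th 0 < th 1 by rewrite (PLn_lt n_ge2 pth).
have th'_le := PLn_le n_ge2 pth'.
have conj_F g : F g -> F (th \o (g \o th')) /\ id_outside (th 0) (th 1) (th \o (g \o th')).
  move=> Fg; have gid : id_outside (th 0) (th 1) (th \o (g \o th')).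
    move=> t /orP[t0|t1] /=; rewrite (F_id_outside n_ge2 Fg) ?thK2 //.
      by rewrite -(thK1 0) th'_le t0.
    by rewrite -(thK1 1) th'_le t1 orbT.
  split=> //; apply: PLn_F => //.
    apply: PLn_comp => //; apply: PLn_comp => //; exact: F_PLn.
  move=> t /orP[t0|t1]; apply: gid; first by rewrite (le_trans t0) // ltW.
  by rewrite (le_trans _ t1) ?orbT // ltW.
have conj_inv g g' : inverse g g' -> inverse (th \o (g \o th')) (th \o (g' \o th')).
  by move=> [gK g'K]; split=> t /=; rewrite thK1 ?gK ?g'K thK2.
have conj_H g : derived F g -> H (th \o (g \o th')).
  elim=> {g} [|_ [x [y [x' [y' [Fx Fy xx' yy' ->]]]]]|g1 g2 _ H1 _ H2|g g' _ Hg gg'].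
  - have -> : th \o (idfun \o th') = idfun by apply/funext => t /=.
    exact: (group_id grp).
  - have -> : th \o (mulF (mulF (mulF x' y') x) y \o th') =
        (th \o (y \o th')) \o ((th \o (x \o th')) \o
        ((th \o (y' \o th')) \o (th \o (x' \o th')))).
      by apply/funext => t; rewrite /mulF /= !thK1.
    have [Fx1 idx] := conj_F x Fx; have [Fy1 idy] := conj_F y Fy.
    by apply: (commutator_in Fx1 Fy1 _ _ idx idy) => //; exact: conj_inv.
  - have -> : th \o (mulF g1 g2 \o th') = (th \o (g2 \o th')) \o (th \o (g1 \o th')).
      by apply/funext => t; rewrite /mulF /= thK1.
    exact: (group_comp grp).
  - by apply: (group_inv grp Hg); exact: conj_inv.
suff -> : f = th \o (f \o th') by exact: conj_H.
have thL : th L = L by rewrite th_mid // lexx ltW.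
have th1L : th (1 - L) = 1 - L by rewrite th_mid // lexx ltW.
have f_le := PLn_le n_ge2 (F_PLn n_ge2 Ff).
apply/funext => t /=.
have [t_in|t_out] := boolP (L <= t <= 1 - L).
  rewrite (inverse_fix thK (th_mid _ t_in)) th_mid //.
  have fL : f L = L by rewrite fe // ltW.
  have f1L : f (1 - L) = 1 - L by rewrite fe //; apply/orP; right; lra.
  by rewrite -{1}fL -{1}f1L !f_le.
move: t_out; rewrite negb_and -!ltNge => /orP[tL|tL].
- rewrite !fe ?thK2 //; apply/orP; left; last by lra.
  by rewrite (le_trans _ (ltW Le)) // -(inverse_fix thK thL) th'_le ltW.
- rewrite !fe ?thK2 //; apply/orP; right; last by lra.
  rewrite (@le_trans _ _ (1 - L)) //; first by lra.
  by rewrite -(inverse_fix thK th1L) th'_le ltW.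
Qed.

End Commutators.

(** * Words read along paths of an automaton *)

Section Labellings.
Context (n : nat).
Implicit Types (u v w : word n).

Record right_congruence (E : word n -> word n -> Prop) : Prop := RightCongruence {
  rc_refl : forall u, E u u;
  rc_sym : forall u v, E u v -> E v u;
  rc_trans : forall v u w, E u v -> E v w -> E u w;
  rc_rcons : forall u v i, E u v -> E (rcons u i) (rcons v i)
}.

(** [L z u] reads: the interval of the word [u] is a model of the vertex [z]. The
    relation [E] compares two models of one vertex, so it bounds how much the
    identifications leading to the automaton may have confused. *)
Record labelling (A : automaton n) (L : vert A -> word n -> Prop)
    (E : word n -> word n -> Prop) : Prop := Labelling {
  lab_total : forall z, exists u, L z u;
  lab_coherent : forall z u v, L z u -> L z v -> E u v;
  lab_edge : forall z i z' u v, edge z i z' -> L z u -> L z' v -> E (rcons u i) v;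
  lab_root : L (aroot A) [::]
}.

Definition respects (A : automaton n) (L : vert A -> word n -> Prop)
    (E : word n -> word n -> Prop) (a b : vert A) : Prop :=
  forall u v, L a u -> L b v -> E u v.

Lemma labelling_weaken A L (E E' : word n -> word n -> Prop) :
  (forall u v, E u v -> E' u v) -> @labelling A L E -> labelling L E'.
Proof.
move=> EE' [tot coh edg rt]; split=> // [z u v zu zv|z i z' u v zz' zu z'v].
- exact/EE'/(coh z).
- exact/EE'/(edg z i z').
Qed.

(** Merging only vertices whose models are related keeps the labelling. *)
Lemma labelling_quotient A L E (e : vert A -> vert A -> Prop) :
  right_congruence E -> @labelling A L E -> (forall a, e a a) ->
  (forall a b, e a b -> respects L E a b) ->
  @labelling (quotient e) (fun C u => exists2 a, C = mkclass e a & L a u) E.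
Proof.
move=> RE [tot coh edg rt] erefl_ eL.
have class_eq a b : mkclass e a = mkclass e b -> e a b.
  by move=> /(congr1 (fun C => sval C)) /= ->.
split=> /=.
- by move=> [C [a Ca]]; have [u au] := tot a; exists u, a => //; subst C.
- by move=> C u v [a -> au] [b /class_eq ab bv]; exact: (eL a b).
- move=> C i C' u v [a [b [ab CE C'E]]] [a1 a1E a1u] [b1 b1E b1v].
  have [ua aua] := tot a; have [ub bub] := tot b.
  have h1 : E u ua by apply: (eL a1 a) => //; apply: class_eq; rewrite -a1E.
  have h2 : E ub v by apply: (eL b b1) => //; apply: class_eq; rewrite -b1E.
  apply: (rc_trans RE) (rc_rcons RE _ h1) _.
  exact: (rc_trans RE) (edg _ _ _ _ _ ab aua bub) h2.
- by exists (aroot A).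
Qed.

Lemma rc_cat E u v w : right_congruence E -> E u v -> E (u ++ w) (v ++ w).
Proof.
move=> RE; elim: w u v => [|i w IH] u v uv; first by rewrite !cats0.
by rewrite -!cat_rcons; apply: IH; exact: (rc_rcons RE).
Qed.

(** A path whose successive edges lie in different trees still transports the
    models, because [E] is compatible with appending letters. *)
Lemma labelling_path A L E (a b : vert A) u v w : right_congruence E ->
  @labelling A L E -> path_from a w b -> L a u -> L b v -> E (u ++ w) v.
Proof.
move=> RE [tot coh edg rt]; elim: w a u => [|i w IH] a u /=.
  by move=> -> au bv; rewrite cats0; exact: coh bv.
move=> [c [ac cb]] au bv; have [uc cuc] := tot c.
rewrite -cat_rcons; apply: (rc_trans RE) (IH _ _ cb cuc bv).
by apply: rc_cat => //; exact: (edg a i c).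
Qed.

Lemma labelling_same_end A L E w1 w2 : right_congruence E ->
  @labelling A L E -> same_end A w1 w2 -> E w1 w2.
Proof.
move=> RE AL [z [p1 p2]]; have [u zu] := lab_total AL z.
apply: (rc_trans RE) (labelling_path RE AL p1 (lab_root AL) zu) _.
exact: (rc_sym RE) (labelling_path RE AL p2 (lab_root AL) zu).
Qed.

Lemma fold1_respects A L E : right_congruence E -> @labelling A L E ->
  forall a b, fold1 a b -> respects L E a b.
Proof.
move=> RE AL a b; elim=> {a b} [a u v|a b _ IH u v au bv|a b c _ IH1 _ IH2 u v au cv|].
- exact: (lab_coherent AL).
- exact: (rc_sym RE) (IH _ _ bv au).
- have [w bw] := lab_total AL b.
  exact: (rc_trans RE) (IH1 _ _ au bw) (IH2 _ _ bw cv).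
- move=> a b i a' b' _ IH aa' bb' u v a'u b'v.
  have [ua aua] := lab_total AL a; have [ub bub] := lab_total AL b.
  apply: (rc_trans RE (rc_sym RE (lab_edge AL aa' aua a'u)) _).
  apply: (rc_trans RE (rc_rcons RE i (IH _ _ aua bub)) _).
  exact: (lab_edge AL bb' bub b'v).
Qed.

(** A folding of type 2 only knows that the children are identified, so related
    children must force related words. *)
Lemma fold2_respects A L E : right_congruence E ->
  (forall u v, (forall i, E (rcons u i) (rcons v i)) -> E u v) -> @labelling A L E ->
  forall a b, fold2 a b -> respects L E a b.
Proof.
move=> RE Esplit AL.
apply: fold2_ind => [a u v|a b _ IH u v au bv|a b c _ IH1 _ IH2 u v au cv|].
- exact: (lab_coherent AL).
- exact: (rc_sym RE) (IH _ _ bv au).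
- have [w bw] := lab_total AL b.
  exact: (rc_trans RE) (IH1 _ _ au bw) (IH2 _ _ bw cv).
- move=> a b a' b' aa' bb' _ IH u v au bv; apply: Esplit => i.
  have [ua aua] := lab_total AL (a' i); have [ub bub] := lab_total AL (b' i).
  apply: (rc_trans RE) (lab_edge AL (aa' i) au aua) _.
  apply: (rc_trans RE) (IH i _ _ aua bub) _.
  exact: (rc_sym RE) (lab_edge AL (bb' i) bv bub).
Qed.

End Labellings.

(** * Intervals of words *)

Section Intervals.
Context {R : realType} (n : nat) (n_ge2 : (2 <= n)%N).
Local Notation N := (n%:R : R).
Local Notation Zn := (@Zn R n).
Implicit Types (u v w : word n) (f g h : R -> R).

(** The affine parametrization of the interval of [w] by [0, 1]; concatenation of
    words becomes composition. *)
Fixpoint param w (t : R) : R :=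
  if w is i :: w' then (i%:R + param w' t) / N else t.

Lemma param_cat u w t : param (u ++ w) t = param u (param w t).
Proof. by elim: u => //= i u ->. Qed.

Lemma param_wval w t : wval w + t * N ^- size w = param w t.
Proof.
elim: w => [|i w IH] /=; first by rewrite /wval big_ord0 add0r expr0 invr1 mulr1.
rewrite -IH /wval /= big_ord_recl /= expr1.
rewrite mulrDl mulrDl exprS invfM mulrCA mulrA [N^-1 * _]mulrC -addrA; congr (_ + (_ + _)).
  rewrite mulr_suml; apply: eq_bigr => j _ /=.
  by rewrite /bump /= add1n exprS invfM mulrCA mulrC.
by rewrite -mulrA [N^-1 * _]mulrC mulrA.
Qed.

Lemma paramE w t : param w t = param w 0 + t * N ^- size w.
Proof. by rewrite -!param_wval mul0r addr0. Qed.

Lemma param_itv w t : 0 <= t <= 1 -> 0 <= param w t <= 1.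
Proof.
move=> t01; elim: w => //= i w /andP[w0 w1].
have N0 := base_gt0 (R := R) n_ge2.
rewrite divr_ge0 ?addr_ge0 ?ler0n ?(ltW N0) //= ler_pdivrMr // mul1r.
apply: le_trans (lerD (lexx _) w1) _.
by rewrite natr1 ler_nat ltn_ord.
Qed.

Lemma Zn_param w t : Zn t -> Zn (param w t).
Proof.
move=> Zt; elim: w => //= i w Zw; apply: ZnM => //; last by rewrite -exprN1; exact: Zn_expz.
by apply: ZnD => //; exact: Zn_nat.
Qed.

Lemma param_digits (M : nat) (a : R) : 0 <= a < 1 ->
  exists w t, [/\ size w = M, 0 <= t < 1 & a = param w t].
Proof.
have N0 := base_gt0 (R := R) n_ge2.
elim: M a => [|M IH] a /andP[a0 a1]; first by exists [::], a; rewrite a0 a1.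
have Na0 : 0 <= N * a by rewrite mulr_ge0 // ltW.
set i := Num.trunc (N * a).
have /andP[i1 i2] := trunc_itv Na0.
have i_n : (i < n)%N.
  by rewrite -(ltr_nat R) (le_lt_trans i1) // -[ltRHS]mulr1 ltr_pM2l.
have [|w [t [sw t01 aw]]] := IH (N * a - i%:R).
  by rewrite subr_ge0 i1 /= ltrBlDr addrC natr1.
exists (Ordinal i_n :: w), t; split=> //=; first by rewrite sw.
by rewrite -aw addrC subrK mulrC mulKf ?gt_eqF.
Qed.

Definition linked h u v : Prop := forall t, 0 <= t <= 1 -> h (param u t) = param v t.

Lemma linked_cat h u v w : linked h u v -> linked h (u ++ w) (v ++ w).
Proof. by move=> uv t t01; rewrite !param_cat uv // param_itv. Qed.

Lemma represents_linked D h u v : represents D h -> (u, v) \in branch_pairs D ->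
  linked h u v.
Proof.
move=> [_ _ hE] uv t /andP[t0 t1].
have Nu : 0 < N ^+ size u by rewrite exprn_gt0 // base_gt0.
rewrite -!param_wval (hE u v uv); last first.
  by rewrite lerDl mulr_ge0 ?invr_ge0 ?(ltW Nu) //= lerD2l ler_piMl // invr_ge0 ltW.
rewrite [wval u + _]addrC addrK; congr (_ + _).
by rewrite -mulrA; congr (_ * _); rewrite mulKf // gt_eqF.
Qed.

Context (H : set (R -> R)) (grp : group_in_F n H).

Definition linked_in u v : Prop := exists2 h, H h & linked h u v.

(** The relation for the core. A folding of type 2 identifies two vertices when
    their children coincide, and the corresponding intervals need not be linked by
    one element of [H], only piece by piece after enough subdivisions. *)
Definition eventually_linked_in u v : Prop :=
  exists k, forall w, (k <= size w)%N -> linked_in (u ++ w) (v ++ w).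

Lemma linked_in_cat u v w : linked_in u v -> linked_in (u ++ w) (v ++ w).
Proof. by move=> [h Hh hE]; exists h => //; exact: linked_cat. Qed.

Lemma linked_in_rc : right_congruence linked_in.
Proof.
split.
- by move=> u; exists idfun => //; exact: (group_id grp).
- move=> u v [h Hh hE]; have [g Hg [hK gK]] := group_inverse n_ge2 grp Hh.
  by exists g => // t t01; rewrite -hE // hK.
- move=> v u w [h Hh hE] [g Hg gE]; exists (g \o h); first exact: (group_comp grp).
  by move=> t t01 /=; rewrite hE // gE.
- by move=> u v i; rewrite -!cats1; exact: linked_in_cat.
Qed.

Lemma eventually_linked_in_rc : right_congruence eventually_linked_in.
Proof.
have RE := linked_in_rc; split.
- by move=> u; exists 0%N => w _; exact: (rc_refl RE).
- by move=> u v [k kE]; exists k => w /kE; exact: (rc_sym RE).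
- move=> v u w [k kE] [j jE]; exists (maxn k j) => x; rewrite geq_max => /andP[kx jx].
  exact: (rc_trans RE) (kE _ kx) (jE _ jx).
- move=> u v i [k kE]; exists k => w kw; rewrite !cat_rcons.
  by apply: kE => /=; exact: leqW.
Qed.

Lemma eventually_linked_in_split u v :
  (forall i, eventually_linked_in (rcons u i) (rcons v i)) -> eventually_linked_in u v.
Proof.
move=> /(@fin_all_exists _ _ (fun i k => forall w, (k <= size w)%N ->
  linked_in (rcons u i ++ w) (rcons v i ++ w))) [k kE].
exists (\max_i k i).+1 => [[//|i w]] /= kw; rewrite -!cat_rcons; apply: kE.
by move: kw; rewrite ltnS; apply: leq_trans; exact: (leq_bigmax i).
Qed.

Lemma linked_in_eventually u v : linked_in u v -> eventually_linked_in u v.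
Proof. by move=> uv; exists 0%N => w _; exact: linked_in_cat. Qed.

Context (X : set (R -> R)) (XH : X `<=` H).

Definition vertex_word (z : vert (forest n X)) (u : word n) : Prop :=
  u = if z is Some x then (sval x).2 else [::].

Lemma forest_labelling : labelling vertex_word linked_in.
Proof.
have RE := linked_in_rc; split.
- by move=> z; eexists.
- by move=> z u v -> ->; exact: (rc_refl RE).
- by move=> [x|//] i [y|//] u v [_ xy] -> ->; rewrite xy; exact: (rc_refl RE).
- by [].
Qed.

Lemma glue_respects (a b : vert (forest n X)) :
  clos_refl_sym_trans _ (@Defs.glue R n X) a b -> respects vertex_word linked_in a b.
Proof.
have RE := linked_in_rc.
elim=> {a b} [a b [x x0|x y D u v uvD xE yE]|a|a b _ IH|a b c _ IH1 _ IH2] u' v'.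
- by move=> -> ->; rewrite x0; exact: (rc_refl RE).
- move=> -> ->; rewrite xE yE /=.
  have [[_ [h Xh Dh]] _] := svalP x; rewrite xE /= in Dh.
  by exists h; [exact: XH|exact: represents_linked uvD].
- by move=> -> ->; exact: (rc_refl RE).
- by move=> au bv; apply: (rc_sym RE); exact: IH.
- move=> au cv; apply: (rc_trans RE) (IH1 _ _ au _) (IH2 _ _ _ cv); reflexivity.
Qed.

Lemma semi_core_labelling : exists L, @labelling n (semi_core n X) L linked_in.
Proof.
have RE := linked_in_rc.
have AL := labelling_quotient RE forest_labelling (@rst_refl _ _) glue_respects.
eexists; exact: (labelling_quotient RE AL (@fold1_refl _ _) (fold1_respects RE AL)).
Qed.

Lemma semi_core_linked u v : same_end (semi_core n X) u v -> linked_in u v.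
Proof.
by have [L SL] := semi_core_labelling; exact: labelling_same_end linked_in_rc SL.
Qed.

Lemma core_linked u v : same_end (core n X) u v -> eventually_linked_in u v.
Proof.
have [L SL] := semi_core_labelling; have RE := eventually_linked_in_rc.
have SL' := labelling_weaken linked_in_eventually SL.
have CL := labelling_quotient RE SL' (@fold2_refl _ _)
  (fold2_respects RE eventually_linked_in_split SL').
exact: labelling_same_end RE CL.
Qed.

End Intervals.

(** * Accepted diagrams *)

Lemma tree_rec_ind (n : nat) (P : tree n -> Prop) :
  P Leaf -> (forall c : {ffun 'I_n -> tree n}, (forall i, P (c i)) -> P (Node c)) ->
  forall T, P T.
Proof.
move=> PL PN; fix IH 1 => -[|c]; first exact: PL.
by apply: PN => i; exact: IH.
Qed.

Lemma deep_word_branch (n : nat) (T : tree n) : exists d, forall w : word n,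
  (d <= size w)%N -> exists u w', [/\ u \in branches T, w = u ++ w' & (size u <= d)%N].
Proof.
elim/tree_rec_ind: T => [|c /fin_all_exists[d dE]].
  by exists 0%N => w _; exists [::], w; rewrite mem_seq1.
exists (\max_i d i).+1 => -[//|i w] /=; rewrite ltnS => mw.
have [|u [w' [uc -> ud]]] := dE i w.
  by apply: leq_trans mw; exact: (leq_bigmax i).
exists (i :: u), w'; split=> //=.
- apply/flattenP; exists [seq i :: w0 | w0 <- branches (c i)].
    by apply/mapP; exists i; rewrite ?mem_enum.
  by apply/mapP; exists u.
- by rewrite ltnS (leq_trans ud) //; exact: (leq_bigmax i).
Qed.

Section Closure.
Context {R : realType} (n : nat) (n_ge2 : (2 <= n)%N).
Local Notation N := (n%:R : R).
Local Notation Zn := (@Zn R n).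
Local Notation F := (@F R n).
Implicit Types (u v w : word n) (f g h : R -> R).

Context (H : set (R -> R)) (grp : group_in_F n H).
Context (X : set (R -> R)) (XH : X `<=` H).

(** A word that is long enough runs through a branch of the first tree and then
    subdivides the interval of that branch far enough to use the acceptance of the
    pair. *)
Lemma Cl_on_deep_words f : Cl n X f -> exists M, forall w, size w = M ->
  exists2 h, H h & forall t, 0 <= t <= 1 -> f (param w t) = h (param w t).
Proof.
move=> [_ [D [Df Dacc]]]; have [Dsize _ _] := Df.
have acc p : p \in branch_pairs D -> eventually_linked_in H p.1 p.2.
  by case: p => u v /Dacc; exact: core_linked.
have [K KE] : exists K, forall p, p \in branch_pairs D -> forall w, (K <= size w)%N ->
    linked_in H (p.1 ++ w) (p.2 ++ w).
  elim: (branch_pairs D) acc => [|p s IH] acc; first by exists 0%N.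
  have [|K KE] := IH; first by move=> q qs; apply: acc; rewrite in_cons qs orbT.
  have [k kE] := acc p (mem_head _ _).
  exists (maxn k K) => q; rewrite in_cons => /orP[/eqP ->|/KE qE] w.
    by rewrite geq_max => /andP[/kE].
  by rewrite geq_max => /andP[_ /qE].
have [d dE] := deep_word_branch D.1.
exists (d + K)%N => w sw; have [|u [w' [uD wE ud]]] := dE w; first by rewrite sw leq_addr.
have [v uv] : exists v, (u, v) \in branch_pairs D.
  exists (nth [::] (branches D.2) (index u (branches D.1))).
  have ui : (index u (branches D.1) < size (branches D.1))%N by rewrite index_mem.
  apply/(nthP ([::], [::])); exists (index u (branches D.1)).
    by rewrite size_zip -Dsize minnn.
  by rewrite nth_zip // nth_index.
have [|h Hh hE] := KE _ uv w'.
  by rewrite -(leq_add2l d) -sw wE size_cat leq_add2r.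
exists h => // t t01; rewrite wE hE // !param_cat.
by apply: (represents_linked n_ge2 Df uv); exact: param_itv.
Qed.

Lemma Cl_piecewise_in f : Cl n X f -> piecewise_in n H f.
Proof.
move=> /Cl_on_deep_words[M ME].
exists [seq param (val w) 1 | w : M.-tuple 'I_n]; split.
  by move=> c /mapP[w _ ->]; apply: Zn_param => //; exact: Zn1.
move=> a b a0 ab b1 fr.
have [|w [t [sw /andP[t0 t1] aE]]] := param_digits n_ge2 M (a := a).
  by rewrite a0 (lt_le_trans ab).
have N0 : 0 < N ^- size w by rewrite invr_gt0 exprn_gt0 // base_gt0.
have bw : b <= param w 1.
  rewrite leNgt; apply/negP => wb; apply: (fr (param w 1)).
    have wM : size w == M by apply/eqP.
    by apply/mapP; exists (Tuple wM); rewrite ?mem_enum.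
  by rewrite wb andbT aE paramE [ltRHS]paramE ltrD2l ltr_pM2r.
have [h Hh hE] := ME w sw; exists h => // x /andP[ax xb].
have -> : x = param w ((x - param w 0) / N ^- size w).
  by rewrite [RHS]paramE divfK ?gt_eqF // addrC subrK.
apply: hE; apply/andP; split.
  rewrite divr_ge0 ?(ltW N0) // subr_ge0 (le_trans _ ax) // aE [leRHS]paramE lerDl.
  by rewrite mulr_ge0 // ltW.
rewrite ler_pdivrMr // mul1r lerBlDl.
by have := le_trans xb bw; rewrite paramE mul1r.
Qed.

Lemma piecewise_in_comp h k : H h -> piecewise_in n H k -> piecewise_in n H (k \o h).
Proof.
move=> Hh [s [Zs sE]]; have [h' Hh' [hK h'K]] := group_inverse n_ge2 grp Hh.
have h_le := group_le n_ge2 grp Hh; have h_lt := group_lt n_ge2 grp Hh.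
exists [seq h' c | c <- s]; split.
  move=> _ /mapP[c /Zs Zc ->].
  by apply/(PLn_Zn_iff n_ge2 _ (F_PLn n_ge2 (group_sub grp Hh'))).
move=> a b a0 ab b1 fr.
have [||||g Hg gE] := sE (h a) (h b).
- by rewrite -(group_0 n_ge2 grp Hh) h_le.
- by rewrite h_lt.
- by rewrite -(group_1 n_ge2 grp Hh) h_le.
- move=> c cs /andP[ac cb]; apply: (fr (h' c)); first exact: map_f.
  by rewrite -[a < _]h_lt -[_ < b]h_lt h'K ac.
exists (g \o h); first exact: (group_comp grp).
by move=> x /andP[ax xb] /=; rewrite gE // !h_le ax.
Qed.

(** The factor [k] is trivial near 0 and 1, so it does not affect the germs. *)
Lemma ends_in h k : H h -> derived F k -> exists2 g, H g &
  exists2 d, 0 < d & forall x, (x <= d) || (1 - d <= x) -> g x = (k \o h) x.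
Proof.
move=> Hh dk; have [_ [e e0 ke]] := derived_F_fix n_ge2 dk.
have [h' Hh' [hK h'K]] := group_inverse n_ge2 grp Hh.
have h_le := group_le n_ge2 grp Hh.
exists h => //; exists (Num.min (h' e) (1 - h' (1 - e))).
  rewrite lt_min (group_gt0 n_ge2 grp) // e0 subr_gt0 (group_lt1 n_ge2 grp) //.
  by rewrite ltrBlDr ltrDl.
move=> x xd /=; rewrite ke //; case/orP: xd => [|xd].
  by rewrite le_min => /andP[xe _]; rewrite -(h'K e) h_le xe.
apply/orP; right; rewrite -(h'K (1 - e)) h_le; apply: le_trans xd.
by rewrite lerBrDr -lerBrDl ge_min lexx orbT.
Qed.

Lemma inner_param u : inner u -> [/\ 0 < param u (0 : R), param u (0 : R) < param u 1
  & param u (1 : R) < 1].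
Proof.
have N0 := base_gt0 (R := R) n_ge2.
move=> /and3P[_ u0 u1]; split.
- elim: u u0 {u1} => //= i u IH; rewrite negb_and => iu.
  have /andP[p0 _] : 0 <= param u (0 : R) <= 1 by apply: param_itv; rewrite // lexx ler01.
  rewrite divr_gt0 //; case/orP: iu => [i0|/IH pu].
    by rewrite ltr_wpDr // ltr0n lt0n.
  by rewrite ltr_wpDl // ler0n.
- by rewrite [ltRHS]paramE ltrDl mul1r invr_gt0 exprn_gt0.
- elim: u u1 {u0} => //= i u IH; rewrite negb_and => iu.
  have /andP[_ p1] : 0 <= param u (1 : R) <= 1 by apply: param_itv; rewrite // lexx ler01.
  rewrite ltr_pdivrMr // mul1r.
  have ipn : (i <= n.-1)%N by rewrite -ltnS (ltn_predK n_ge2) ltn_ord.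
  have nE : N = (n.-1)%:R + 1 by rewrite natr1 (ltn_predK n_ge2).
  case/orP: iu => [i1|/IH pu].
    by rewrite nE ltr_leD // ltr_nat ltn_neqAle i1.
  by rewrite nE ler_ltD // ler_nat.
Qed.

Lemma wval_cong w : cong n (wval w : R) (wtype w)%:R.
Proof.
have -> : wval w = param w (0 : R) by rewrite -param_wval mul0r addr0.
suff H1 : cong n (param w (0 : R)) (\sum_(i <- w) nat_of_ord i)%:R.
  apply: (cong_trans n_ge2) H1 _; rewrite /wtype.
  set k := (\sum_(i <- w) _)%N.
  rewrite {1}(divn_eq k n.-1) natrD natrM mulrC.
  have := congD n_ge2 (cong_mul n_ge2 (Zn_nat n (k %/ n.-1)%N))
    (cong_refl n ((k %% n.-1)%N%:R : R)).
  by rewrite add0r.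
elim: w => [|i w IH] /=; first by rewrite big_nil; exact: cong_refl.
have Zi : Zn (i%:R + param w 0).
  by apply: ZnD => //; [exact: Zn_nat|apply: Zn_param => //; exact: Zn0].
rewrite big_cons natrD mulrC -exprN1.
apply: (cong_trans n_ge2) (cong_scale n_ge2 _ Zi) _.
by apply: congD => //; exact: cong_refl.
Qed.

Lemma cong_nat (al : R) : Zn al -> exists2 i, (i < n.-1)%N & cong n al i%:R.
Proof.
move=> [k [m ->]]; have n1 : (0 < n.-1)%N by case: n n_ge2 => [|[]].
have n1z : n.-1%:Z != 0 by rewrite -lt0n in n1 *; case: (n.-1) n1.
have := modz_ge0 k n1z; have := ltz_pmod k (n1 : 0 < n.-1%:Z).
case kE : (k %% n.-1)%Z => [i|//] in_ _; exists i; first by [].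
have ck : cong n (k%:~R / N ^+ m : R) k%:~R.
  by rewrite mulrC exprnN; apply: cong_scale => //; exact: Zn_int.
apply: (cong_trans n_ge2) ck _; rewrite (divz_eq k n.-1) kE intrD intrM mulrC.
have := congD n_ge2 (cong_mul n_ge2 (Zn_int n (k %/ n.-1)%Z)) (cong_refl n (i%:R : R)).
by rewrite add0r.
Qed.

Lemma germ_cvg_slope (d : R) h (a s : R) k (G : set_system R) : ProperFilter G ->
  d * d = 1 -> h a = a -> germ n d h a k ->
  (forall e : R, 0 < e -> \forall x \near G, 0 < d * (x - a) <= e) ->
  (h x - h a) / (x - a) @[x --> G] --> s -> N ^ k = s.
Proof.
move=> GG dd ha [e e0 hE] Gnear hs.
suff : (h x - h a) / (x - a) @[x --> G] --> N ^ k.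
  by move=> /cvg_lim <- //; exact/cvg_lim.
apply: cvg_near_cst; have := Gnear e e0; apply: filterS => x /andP[x0 xe].
have := hE (d * (x - a)); rewrite mulrA dd mul1r (ltW x0) xe => /(_ isT).
have -> : a + (x - a) = x by ring.
move=> ->; rewrite ha.
have -> : a + d * (N ^ k * (d * (x - a))) - a = d * d * (N ^ k * (x - a)) by ring.
rewrite dd mul1r mulfK //.
by apply/eqP => xa; move: x0; rewrite xa mulr0 ltxx.
Qed.

Lemma left_slope h (a s : R) k : h a = a -> germ n (-1) h a k -> left_derivative h a s ->
  N ^ k = s.
Proof.
move=> ha hg; apply: (germ_cvg_slope _ _ ha hg); first by rewrite mulrNN mul1r.
move=> e e0; near=> x.
have xa : x < a by near: x; exact: nbhs_left_lt.
have ax : a - e < x by near: x; apply: nbhs_left_gt; rewrite ltrBlDr ltrDl.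
by lra.
Unshelve. all: by end_near. Qed.

Lemma right_slope h (a s : R) k : h a = a -> germ n 1 h a k -> right_derivative h a s ->
  N ^ k = s.
Proof.
move=> ha hg; apply: (germ_cvg_slope _ _ ha hg); first by rewrite mul1r.
move=> e e0; near=> x.
have xa : a < x by near: x; exact: nbhs_right_gt.
have ax : x < a + e by near: x; apply: nbhs_right_lt; rewrite ltrDl.
by lra.
Unshelve. all: by end_near. Qed.

End Closure.

(** * The generation theorem *)

Section Endgame.
Context {R : realType} (n : nat) (n_ge2 : (2 <= n)%N).
Local Notation N := (n%:R : R).
Local Notation Zn := (@Zn R n).
Local Notation F := (@F R n).
Implicit Types (u v w : word n) (f g h : R -> R).

Lemma generated_group (X : set (R -> R)) : X `<=` F -> group_in_F n (generated X).
Proof.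
move=> XF; split.
- move=> f; elim=> {f} [|f /XF //|f g _ Ff _ Fg|f g _ Ff fg]; first exact: F_id.
    exact: F_comp.
  exact: F_inv fg.
- exact: generated_id.
- by move=> f g Hf Hg; exact: generated_mul.
- by move=> f g Hf fg; exact: generated_inv fg.
Qed.

Context (H : set (R -> R)) (grp : group_in_F n H).
Context (pw : forall f, F f -> piecewise_in n H f).

(** The interval of [u] is linked to that of [u] followed by [m] zeros, which is
    as short as wanted and has the same left end; and that end can be moved
    anywhere in its congruence class. *)
Lemma shrink_word u : inner u ->
  (forall v1 v2, wtype v1 = wtype v2 -> linked_in H (u ++ v1) (u ++ v2)) ->
  forall p q : R, 0 <= p -> p < q -> q <= 1 ->
  exists2 g, H g & p < g (param u 0) /\ g (param u 1) < q.
Proof.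
move=> ui links p q p0 pq q1; have [l0 le e1] := inner_param (R := R) n_ge2 ui.
have l1 := lt_trans le e1; set l := param u 0 in l0 le l1 *.
have Zl : Zn l by apply: Zn_param => //; exact: Zn0.
have [al [Zal alc /andP[pal alq]]] := dense_cong n_ge2 pq Zl.
have [||f Ff fl] := @F_move R n n_ge2 l al Zl Zal _ _ (cong_sym alc).
- by rewrite l0.
- by rewrite (le_lt_trans p0) // (lt_le_trans alq).
have [|h Hh hl] := same_orbits pw Ff (x := l); first by rewrite (ltW l0).
rewrite fl in hl.
have [k [e e0 hE]] := germ_exists l (mul1r 1) (F_PLn n_ge2 (group_sub grp Hh)).
have Nk := base_expz_gt0 (R := R) n_ge2 k.
have [|m] := @small_expn R n n_ge2 (Num.min e ((q - al) / N ^ k)).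
  by rewrite lt_min e0 divr_gt0 // subr_gt0.
rewrite lt_min => /andP[me mq].
set z : word n := nseq m (Ordinal (ltn_trans (ltn0Sn _) n_ge2)).
have zt : wtype ([::] : word n) = wtype z.
  rewrite /wtype big_nil /z big_nseq; congr (_ %% _)%N.
  by elim: m {me mq z} => //= m IH; rewrite add0n -IH.
have zE t : param z t = t * N ^- m.
  rewrite /z; elim: m {me mq z zt} => [|m IH]; first by rewrite expr0 invr1 mulr1.
  by rewrite /= add0r IH exprS invfM mulrCA mulrC.
have [g Hg gE] := links [::] z zt; exists (h \o g); first exact: (group_comp grp).
have gE' t : 0 <= t <= 1 -> g (param u t) = param u (t * N ^- m).
  by move=> t01; have := gE t t01; rewrite cats0 param_cat zE.
have Nm : 0 < N ^- m by rewrite invr_gt0 exprn_gt0 // base_gt0.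
split=> /=; first by rewrite gE' ?lexx ?ler01 // mul0r hl.
rewrite gE' ?lexx ?ler01 // mul1r.
have us : N ^- m * N ^- size u <= N ^- m.
  by rewrite ler_piMr ?(ltW Nm) // invf_le1 ?exprn_gt0 ?base_gt0 // exprn_ege1 // ltW // base_gt1.
have um0 : 0 < N ^- m * N ^- size u by rewrite mulr_gt0 // invr_gt0 exprn_gt0 // base_gt0.
have := hE (N ^- m * N ^- size u); rewrite mul1r -[l + _]paramE => ->.
  rewrite hl mul1r -ltrBrDl.
  apply: (@le_lt_trans _ _ (N ^ k * N ^- m)); first by rewrite ler_pM2l.
  by rewrite mulrC -ltr_pdivlMr.
by rewrite (ltW um0) (le_trans us) // ltW.
Qed.

(** A congruence class is one orbit, and conjugation preserves the two slopes at a
    fixed point. *)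
Lemma bump_everywhere :
  (forall i : nat, (i < n.-1)%N -> exists (h : R -> R) (a : R),
     [/\ H h, Dtype n i a, h a = a, left_derivative h a 1 & right_derivative h a N]) ->
  forall al : R, Zn al -> 0 < al < 1 -> exists h,
  [/\ H h, h al = al, germ n (-1) h al 0 & germ n 1 h al 1].
Proof.
move=> slopes al Zal al01.
have [i i_n ali] := cong_nat n_ge2 Zal.
have [h [a [Hh [Za a01 [w [aw wi]]] ha hl hr]]] := slopes i i_n.
have ala : cong n al a.
  apply: (cong_trans n_ge2) ali _; rewrite -wi aw.
  by apply: cong_sym => //; exact: wval_cong.
have [f Ff fal] := F_move n_ge2 Zal Za al01 a01 ala.
have [|c Hc cal] := same_orbits pw Ff (x := al); first by case/andP: al01 => /ltW ->.
rewrite fal in cal.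
have [c' Hc' cc'] := group_inverse n_ge2 grp Hc.
have ph := F_PLn n_ge2 (group_sub grp Hh); have pc := F_PLn n_ge2 (group_sub grp Hc).
have c'a : c' a = al by rewrite -cal (proj1 cc').
have dd : (-1) * (-1) = 1 :> R by rewrite mulrNN mul1r.
have [k kh] := germ_exists a dd ph; have [j jh] := germ_exists a (mul1r 1) ph.
have k0 : k = 0.
  by apply: (@base_expz_inj R n n_ge2); rewrite (left_slope ha kh hl) expr0z.
have j1 : j = 1.
  by apply: (@base_expz_inj R n n_ge2); rewrite (right_slope ha jh hr) expr1z.
have conj_germ d s : d * d = 1 -> germ n d h a s -> germ n d (c' \o (h \o c)) al s.
  move=> dd1 hs; have [t ct] := germ_exists al dd1 pc.
  have -> : s = t + s + - t by ring.
  apply: germ_comp => //=; last by rewrite cal ha -cal; exact: germ_inv ct cc'.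
  by apply: germ_comp => //; rewrite cal.
exists (c' \o (h \o c)); split.
- by apply: (group_comp grp) => //; exact: (group_comp grp).
- by rewrite /= cal ha.
- by apply: conj_germ => //; rewrite -k0.
- by apply: conj_germ; rewrite ?mul1r // -j1.
Qed.

End Endgame.

Theorem theorem1p1 (R : realType) (n : nat) (n_ge2 : (2 <= n)%N)
    (X : set (R -> R)) (XF : X `<=` F n)
    (derived_sub : derived (F n) `<=` Cl n X)
    (surj_ab : prod_set (generated X) (derived (F n)) = F n)
    (slopes : forall i : nat, (i < n.-1)%N ->
      exists (h : R -> R) (a : R),
        [/\ generated X h, Dtype n i a, h a = a,
            left_derivative h a 1 & right_derivative h a n%:R])
    (absorbing : exists u : word n, inner u /\
      forall v1 v2 : word n, wtype v1 = wtype v2 ->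
        same_end (semi_core n X) (u ++ v1) (u ++ v2)) :
  generated X = F n.
Proof.
have grp := generated_group n_ge2 XF; set H := generated X in grp surj_ab slopes *.
have XH : X `<=` H by move=> f Xf; exact: generated_in.
have factor f : F n f -> exists h k, [/\ H h, derived (F n) k & f = k \o h].
  by rewrite -{1}surj_ab => -[h [k [Hh dk ->]]]; exists h, k; split.
have pw f : F n f -> piecewise_in n H f.
  move=> /factor[h [k [Hh dk ->]]]; apply: (piecewise_in_comp n_ge2 grp Hh).
  by apply: (Cl_piecewise_in n_ge2 grp XH); exact: derived_sub.
have ends f : F n f -> exists2 g, H g &
    exists2 d, 0 < d & forall x, (x <= d) || (1 - d <= x) -> g x = f x.
  by move=> /factor[h [k [Hh dk ->]]]; exact: (ends_in n_ge2 grp Hh dk).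
have [u [ui uE]] := absorbing.
have base := shrink_word n_ge2 grp pw ui
  (fun v1 v2 v12 => semi_core_linked n_ge2 grp XH (uE v1 v2 v12)).
have squash := compress n_ge2 grp pw ends (inner_param n_ge2 ui) base.
have bump := bump_everywhere n_ge2 grp pw slopes.
have local := locally_all n_ge2 grp ends squash bump pw.
have derived_H := derived_in n_ge2 grp (push_left n_ge2 pw) local.
apply/seteqP; split=> f; first exact: (group_sub grp).
by move=> /factor[h [k [Hh /derived_H Hk ->]]]; exact: (group_comp grp).
Qed.
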